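(* Let $(\mathcal{R},\mu)$ be a $\sigma$-finite resonant measure space, let $X$ be a rearrangement-invariant Banach function space over it and let $X'$ be its associate space. Assume that both $X$ and $X'$ have the (ACR) property. Let $\phi\colon\mathcal{R}\to\mathcal{R}$ satisfy condition (I) (see context). Let $T_\phi f=f\circ\phi$ be the composition operator, and let $T$ be the $\xi$-limit operator of its Ces\`aro means, i.e. $Tf=\xi\text{-}\lim_{n\to\infty}\frac1n\sum_{i=0}^{n-1}T_\phi^i f$ for $f\in X$. Then for every $f\in X_a$ $$\frac1n\sum_{i=0}^{n-1}T_\phi^i f\to Tf\quad\mu\text{-a.e. as }n\to\infty.$$
   Context: $\mathbb{N}$ contains $0$. $\mathcal{M}=\mathcal{M}(\mathcal{R},\mu)$ is the set of extended complex-valued $\mu$-measurable functions on $\mathcal{R}$ (identified when equal $\mu$-a.e.), $\mathcal{M}_+$ the non-negative ones; $\lambda$ is Lebesgue measure. For $f\in\mathcal{M}$ put $f_*(s)=\mu(\{|f|>s\})$ and $f^*(t)=\inf\{s\ge0:\ f_*(s)\le t\}$, $s,t\in[0,\infty)$. A $\sigma$-finite $(\mathcal{R},\mu)$ is resonant if $\sup_{\tilde g\in\mathcal{M},\,\tilde g^*=g^*}\int_{\mathcal{R}}|f\tilde g|\,d\mu=\int_0^\infty f^*g^*\,d\lambda$ for all $f,g\in\mathcal{M}$ (equivalently, it is non-atomic, or completely atomic with all atoms of equal measure). A Banach function norm is a map $\lVert\cdot\rVert\colon\mathcal{M}\to[0,\infty]$ with $\lVert\,|f|\,\rVert=\lVert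 f\rVert$ whose restriction to $\mathcal{M}_+$ satisfies: (P1) it is absolutely homogeneous, vanishes exactly at $f=0$ a.e., and is subadditive; (P2) $f\le g$ a.e. implies $\lVert f\rVert\le\lVert g\rVert$; (P3) $f_n\uparrow f$ a.e. implies $\lVert f_n\rVert\uparrow\lVert f\rVert$; (P4) $\lVert\chi_E\rVert<\infty$ if $\mu(E)<\infty$; (P5) if $\mu(E)<\infty$ there is a finite $C_E$ with $\int_E f\,d\mu\le C_E\lVert f\rVert$ for all $f\in\mathcal{M}_+$. It is rearrangement-invariant (r.i.) if $f^*=g^*$ implies $\lVert f\rVert=\lVert g\rVert$. The corresponding space is $X=\{f\in\mathcal{M}:\lVert f\rVert_X<\infty\}$. The associate space $X'$ is defined by the same recipe from $\lVert f\rVert_{X'}=\sup_{\lVert g\rVert_X\le1}\int_{\mathcal{R}}|fg|\,d\mu$. An r.i. space $Y$ has the (ACR) property if $\lim_{t\to\infty}f^*(t)=0$ for every $f\in Y$. $X_a$ is the set of $f\in X$ with absolutely continuous norm, i.e. $\lVert f\chi_{E_k}\rVert_X\to0$ for every sequence of measurable sets with $\chi_{E_k}\to0$ $\mu$-a.e. $\xi$ on $X$ is the locally convex topology induced by the norms $|f|_\varphi=\int_0^\infty\varphi^*f^*\,d\lambda$, $\varphi\in X'$. A measurable $\phi$ is power-measure-bounded if there is $A\in(0,\infty)$ with $\mu(\phi^{-n}(E))\le A\,\mu(E)$ for all $n\ge1$ and all measurable $E$ ($\phi^{-n}(E)$ is the preimage under the $n$-fold composition $\phi^n$). Condition (I):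 $\phi$ is power-measure-bounded and at least one of the following holds: (a) $\mu(\phi^{-1}(E))\le\mu(E)$ for every measurable $E$ (the measure-bound of $\phi$ is at most $1$); (b) there is $C>0$ with $C\mu(E)\le\mu(\phi^{-i}(E))$ for every $i\in\mathbb{N}$ and every measurable $E\subseteq\mathcal{R}$. Under the stated hypotheses the $\xi$-limit defining $Tf$ exists for every $f\in X$ and $T$ is a linear operator continuous on $(X,\xi)$ and on $(X,\lVert\cdot\rVert_X)$. *)

(* Defs.v *)
From HB Require Import structures.
From mathcomp Require Export all_boot all_order all_algebra.
From mathcomp Require Export complex.
From mathcomp Require Export all_classical all_reals all_analysis.
From mathcomp Require Export measurable_realfun one_point_compactification.
Export numFieldNormedType.Exports.

Set Implicit Arguments.
Unset Strict Implicit.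
Unset Printing Implicit Defensive.

Import Order.TTheory GRing.Theory Num.Theory.

Local Open Scope classical_set_scope.
Local Open Scope ring_scope.
Local Open Scope ereal_scope.

Section ExtendedComplex.
Context {R : realType}.

(* The regular module [R[i]^o] is the copy of [R[i]] carrying the topology of
   the modulus. *)
Definition xcomplex : Type := one_point_compactification R[i]^o.

Definition xfin (z : R[i]) : xcomplex := Some z.
Definition xinfty : xcomplex := None.
Definition xzero : xcomplex := xfin 0%R.

Definition xmod (z : xcomplex) : \bar R :=
  if z is Some w then (ComplexField.Normc.normc w)%:E else +oo.

(* Only meant for values in [0, +oo]. *)
Definition xpos (r : \bar R) : xcomplex :=
  if r is r'%:E then xfin (real_complex R r') else xinfty.

(* Any sum involving oo is oo, including oo - oo; such values only occur on
   null sets for elements of a Banach function space. *)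
Definition xadd (z w : xcomplex) : xcomplex :=
  match z, w with
  | Some a, Some b => xfin (a + b)%R
  | _, _ => xinfty
  end.

(* As for extended reals, 0 * oo = 0. *)
Definition xscale (a : R[i]) (z : xcomplex) : xcomplex :=
  if z is Some w then xfin (a * w)%R
  else if a == 0%R then xzero else xinfty.

Definition xsub (z w : xcomplex) : xcomplex := xadd z (xscale (- 1)%R w).

End ExtendedComplex.
Arguments xcomplex R : clear implicits.

Section FunctionSpaces.
Context {d : measure_display} {T : measurableType d} {R : realType}.
Variable mu : {measure set T -> \bar R}.
Implicit Types (f g : T -> xcomplex R) (N : (T -> xcomplex R) -> \bar R).

(* Borel measurability for the topology of the Riemann sphere. *)
Definition xmeasurable f : Prop :=
  measurable_fun [set: T] (f : T -> g_sigma_algebraType (@open (xcomplex R))).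

(* Elements of M_+, viewed in M through [xpos]. *)
Definition nonneg_measurable (u : T -> \bar R) : Prop :=
  measurable_fun [set: T] u /\ forall x, 0 <= u x.

Definition xabs f : T -> xcomplex R := fun x => xpos (xmod (f x)).

Definition distribution_function f (s : R) : \bar R :=
  mu [set x | s%:E < xmod (f x)].

Definition rearrangement f (t : R) : \bar R :=
  ereal_inf [set s%:E | s in
    [set s : R | (0 <= s)%R /\ distribution_function f s <= t%:E]].

Definition equimeasurable f g : Prop :=
  forall t : R, (0 <= t)%R -> rearrangement f t = rearrangement g t.

Definition rearrangement_pairing f g : \bar R :=
  \int[lebesgue_measure]_(t in `[0%R, +oo[%classic)
    (rearrangement f t * rearrangement g t).

Definition resonant : Prop :=
  sigma_finite [set: T] mu /\
  forall f g, xmeasurable f -> xmeasurable g ->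
    ereal_sup [set \int[mu]_x (xmod (f x) * xmod (h x)) | h in
      [set h | xmeasurable h /\ equimeasurable h g]]
    = rearrangement_pairing f g.

(* The values of [N] on non-measurable functions are irrelevant. *)
Record banach_function_norm N : Prop := BanachFunctionNorm {
  bfn_ge0 : forall f, xmeasurable f -> 0 <= N f;
  bfn_abs : forall f, xmeasurable f -> N (xabs f) = N f;
  bfn_homogeneous : forall (a : R[i]) u, nonneg_measurable u ->
    N (fun x => xscale a (xpos (u x))) =
    (ComplexField.Normc.normc a)%:E * N (xpos \o u);
  bfn_eq0 : forall u, nonneg_measurable u ->
    N (xpos \o u) = 0 <-> {ae mu, forall x, u x = 0};
  bfn_subadditive : forall u v, nonneg_measurable u -> nonneg_measurable v ->
    N (fun x => xpos (u x + v x)) <= N (xpos \o u) + N (xpos \o v);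
  bfn_monotone : forall u v, nonneg_measurable u -> nonneg_measurable v ->
    {ae mu, forall x, u x <= v x} -> N (xpos \o u) <= N (xpos \o v);
  bfn_monotone_limit : forall (u_ : nat -> T -> \bar R) u,
    (forall n, nonneg_measurable (u_ n)) -> nonneg_measurable u ->
    {ae mu, forall x, nondecreasing_seq (u_ ^~ x) /\
                      u_ n x @[n --> \oo] --> u x} ->
    nondecreasing_seq (fun n => N (xpos \o u_ n)) /\
    N (xpos \o u_ n) @[n --> \oo] --> N (xpos \o u);
  bfn_indic_fin : forall E, measurable E -> mu E < +oo ->
    N (fun x => xpos (\1_E x)%:E) < +oo;
  bfn_integral : forall E, measurable E -> mu E < +oo ->
    exists C : R, forall u, nonneg_measurable u ->
      \int[mu]_(x in E) u x <= C%:E * N (xpos \o u)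
}.

Definition rearrangement_invariant N : Prop :=
  forall f g, xmeasurable f -> xmeasurable g -> equimeasurable f g -> N f = N g.

Definition function_space N : set (T -> xcomplex R) :=
  [set f | xmeasurable f /\ N f < +oo].

Definition associate_norm N f : \bar R :=
  ereal_sup [set \int[mu]_x (xmod (f x) * xmod (g x)) | g in
    [set g | xmeasurable g /\ N g <= 1]].

Definition ACR N : Prop :=
  forall f, function_space N f -> rearrangement f t @[t --> +oo%R] --> 0.

Definition abs_continuous_part N : set (T -> xcomplex R) :=
  [set f | function_space N f /\
    forall E : nat -> set T, (forall k, measurable (E k)) ->
      {ae mu, forall x, (\1_(E k) x : R) @[k --> \oo] --> 0%R} ->
      N (patch (fun=> xzero) (E k) f) @[k --> \oo] --> 0].

(* Neighbourhoods of [f] in the locally convex topology xi on X: the basic ones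
   are the finite intersections of balls for |.|_phi, with phi in X'. *)
Definition xi_nbhs N f : set_system (T -> xcomplex R) :=
  [set U | exists (k : nat) (phi : 'I_k -> T -> xcomplex R) (e : R),
    [/\ (0 < e)%R,
        forall j, function_space (associate_norm N) (phi j) &
        [set g | function_space N g /\ forall j,
           rearrangement_pairing (phi j) (fun x => xsub (g x) (f x)) < e%:E]
        `<=` U]].

Definition xi_limit N (u : nat -> T -> xcomplex R) f : Prop :=
  function_space N f /\ cvg_to (u n @[n --> \oo]) (xi_nbhs N f).

Definition power_measure_bounded (phi : T -> T) : Prop :=
  exists A : R, (0 < A)%R /\
    forall (n : nat) (E : set T), (1 <= n)%N -> measurable E ->
      mu (iter n phi @^-1` E) <= A%:E * mu E.

Definition conditionI (phi : T -> T) : Prop :=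
  [/\ measurable_fun [set: T] phi,
      power_measure_bounded phi &
      (forall E : set T, measurable E -> mu (phi @^-1` E) <= mu E) \/
      (exists C : R, (0 < C)%R /\
         forall (i : nat) (E : set T), measurable E ->
           C%:E * mu E <= mu (iter i phi @^-1` E))].

End FunctionSpaces.

Section Cesaro.
Context {T : Type} {R : realType}.

Definition composition_operator (phi : T -> T) (f : T -> xcomplex R) :
  T -> xcomplex R := f \o phi.

Definition cesaro_mean (phi : T -> T) (n : nat) (f : T -> xcomplex R) :
    T -> xcomplex R :=
  fun x => xscale (n%:R^-1)%R
    (\big[xadd/xzero]_(i < n) iter i (composition_operator phi) f x).

End Cesaro.

(* Main.v *)
Require Import Defs.
From mathcomp Require Import ring lra.

(** The convergence holds because [f] lies in L^1 + L^oo and a weak-type maximal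
    inequality controls the averages of L^1 functions, while xi-convergence is
    strong enough to play the part of the mean ergodic theorem.

    Maximal inequality. For [u >= 0] and [l > 0] let [M_n] be the largest of the
    sums [sum_(i < k) (u - l) o phi^i] over [k <= n], the empty sum included.
    Hopf's argument gives [l 1_{M_n > 0} + M_n <= u + M_n o phi]
    ([excess_hopf]). If [phi] does not increase measure, the integral of
    [M_n o phi] is at most that of [M_n] and integrating once gives
    [l mu(M_n > 0) <= int u] ([weak_type_contraction]). If instead
    [C mu(E) <= mu(phi^-i(E)) <= A mu(E)] for all [i], the inequality is summed
    along [phi^0, ..., phi^(L-1)]: the terms in [M_n] telescope, the boundary term
    stays bounded by [A int M_n], and dividing by [L] leaves
    [C l mu(M_n > 0) <= A int u] ([weak_type_bounded_below]). Either way the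
    supremum of the averages of [u] is of weak type (1,1).

    From mean to pointwise convergence. Let [A_n f] be the averages of [f] and
    suppose that [h_n = A_n f - g] tends to 0 in L^1 + L^oo. Then [g] is
    [phi]-invariant a.e. ([limit_invariant]), and
    [A_m f - g = A_m (f - A_n f) + A_m h_n]. For fixed [n] the first term is a
    coboundary average, which tends to 0 a.e. as soon as [f o phi^m / m] does
    ([birkhoff_sum_average], [ae_sublinear_orbit]); the second one is small off
    a set of small measure, uniformly in [m], by the maximal inequality. Letting
    [n] grow gives [pointwise_ergodic].

    From xi to L^1 + L^oo. Pairing [h] with the indicator of a set [E] of positive
    finite measure integrates [h^*] over [0, mu(E)). When this is less than
    [e mu(E)], the set [{|h| > e}] has measure at most [mu(E)], and the Hardy-Littlewood
    inequality, which is half of resonance, bounds the integral of [|h|] over it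
    ([pairing_xindic_integral]). As indicators of sets of finite measure belong to
    the associate space, xi-convergence implies convergence in L^1 + L^oo
    ([xi_limit_tail]). Elements of [X] belong to L^1 + L^oo because their
    rearrangements vanish at infinity, so that [{|f| > s}] has finite measure
    ([integral_xmod_gt_fin]). The real theorem is then applied to real and
    imaginary parts. *)

Set Implicit Arguments.
Unset Strict Implicit.
Unset Printing Implicit Defensive.

Import Order.TTheory GRing.Theory Num.Theory.

Local Open Scope classical_set_scope.
Local Open Scope ring_scope.
Local Open Scope ereal_scope.

(** * Orbit sums and Hopf's inequality *)

Definition birkhoff_sum {T : Type} {R : realType} (phi : T -> T) (n : nat)
    (f : T -> R) (x : T) : R :=
  (\sum_(i < n) f (iter i phi x))%R.

(** The running maximum over [k <= n] of [birkhoff_sum phi k u - k l], written as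
    a recursion along the orbit so that Hopf's inequality can be read off. *)
Fixpoint excess {T : Type} {R : realType} (phi : T -> T) (u : T -> R) (l : R)
    (n : nat) (x : T) : R :=
  if n is m.+1 then Num.max 0%R (u x - l + excess phi u l m (phi x))%R else 0%R.

Section OrbitSums.
Context {T : Type} {R : realType} (phi : T -> T).
Implicit Types (f u : T -> R) (l : R).

Lemma birkhoff_sum0 f x : birkhoff_sum phi 0 f x = 0%R.
Proof. by rewrite /birkhoff_sum big_ord0. Qed.

Lemma birkhoff_sumSl n f x :
  birkhoff_sum phi n.+1 f x = (f x + birkhoff_sum phi n f (phi x))%R.
Proof.
rewrite /birkhoff_sum big_ord_recl; congr (_ + _)%R.
by apply: eq_bigr => i _; rewrite -iterSr.
Qed.

Lemma birkhoff_sumSr n f x :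
  birkhoff_sum phi n.+1 f x = (birkhoff_sum phi n f x + f (iter n phi x))%R.
Proof. by rewrite /birkhoff_sum big_ord_recr. Qed.

Lemma birkhoff_sum_ge0 n u x : (forall y, 0 <= u y)%R ->
  (0 <= birkhoff_sum phi n u x)%R.
Proof. by move=> u0; apply: sumr_ge0. Qed.

Lemma excess_ge0 u l n x : (0 <= excess phi u l n x)%R.
Proof. by case: n => //= n; rewrite le_max lexx. Qed.

Lemma excess_nondecreasing u l n x :
  (excess phi u l n x <= excess phi u l n.+1 x)%R.
Proof.
elim: n x => [|n IH] x; first exact: excess_ge0.
by rewrite [leRHS]/= [leLHS]/= ge_max !le_max lexx/= lerD2l IH orbT.
Qed.

Lemma excess_birkhoff_sum u l n x :
  (birkhoff_sum phi n u x - l * n%:R <= excess phi u l n x)%R.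
Proof.
elim: n x => [|n IH] x; first by rewrite birkhoff_sum0 mulr0 subrr.
rewrite birkhoff_sumSl /= le_max; apply/orP; right.
by move: (IH (phi x)); rewrite -natr1 mulrDr mulr1; lra.
Qed.

Lemma excess_le_birkhoff_sum u l n x : (0 <= l)%R -> (forall y, 0 <= u y)%R ->
  (excess phi u l n x <= birkhoff_sum phi n u x)%R.
Proof.
move=> l0 u0; elim: n x => [|n IH] x; first by rewrite birkhoff_sum0.
rewrite birkhoff_sumSl /= ge_max; move: (IH (phi x)) (u0 x) => ? ?.
have ? := birkhoff_sum_ge0 n (phi x) u0.
by apply/andP; split; [exact: addr_ge0|lra].
Qed.

(** Where [excess] is positive at time [n], it equals [u - l] plus the excess at
    time [n - 1] from [phi x], and the latter only grows with time. *)
Lemma excess_hopf u l n x : (0 <= l)%R -> (forall y, 0 <= u y)%R ->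
  (l * \1_[set y | 0 < excess phi u l n y]%R x + excess phi u l n x
   <= u x + excess phi u l n (phi x))%R.
Proof.
move=> l0 u0; rewrite indicE; have [xE|xE] := boolP (x \in _); last first.
  have -> : excess phi u l n x = 0%R.
    apply/eqP; rewrite eq_le excess_ge0 andbT leNgt; apply/negP => h.
    by move/negP: xE; apply; rewrite inE.
  by rewrite mulr0 addr0 addr_ge0 ?excess_ge0.
rewrite mulr1; move: xE; rewrite inE/=; case: n => [|n]; first by rewrite /= ltxx.
move=> xE; have := excess_nondecreasing u l n (phi x).
by move: xE; rewrite {1 2}/excess -/excess lt_max ltxx/= => h; rewrite (max_r (ltW h)); lra.
Qed.

End OrbitSums.

(** * Measurability along orbits and the weak-type maximal inequality *)

Section Orbits.
Context {d : measure_display} {T : measurableType d} {R : realType}.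
Context (mu : {measure set T -> \bar R}).
Context (phi : T -> T).
Context (mphi : measurable_fun [set: T] phi).

Lemma measurable_iter n : measurable_fun [set: T] (iter n phi).
Proof.
elim: n => [|n IH]; first exact: measurable_id.
by rewrite (_ : iter n.+1 phi = phi \o iter n phi)//; apply: measurableT_comp.
Qed.

Lemma measurable_comp_iter (u : T -> R) n :
  measurable_fun [set: T] u -> measurable_fun [set: T] (u \o iter n phi).
Proof. by move=> mu_; apply: measurableT_comp => //; apply: measurable_iter. Qed.

Lemma measurable_birkhoff_sum (u : T -> R) n :
  measurable_fun [set: T] u -> measurable_fun [set: T] (birkhoff_sum phi n u).
Proof.
move=> mu_; apply: measurable_sum => i; exact: measurable_comp_iter.
Qed.

Lemma measurable_excess (u : T -> R) l n :
  measurable_fun [set: T] u -> measurable_fun [set: T] (excess phi u l n).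
Proof.
move=> mu_; elim: n => [|n IH]; first exact: measurable_cst.
apply: measurable_maxr => //; apply: measurable_funD.
  exact: measurable_funB.
exact: (measurableT_comp IH).
Qed.

(** [1 <= A] lets the bound include [n = 0]. *)
Definition power_bounded_by (A : R) :=
  (1 <= A)%R /\ forall n (E : set T), measurable E ->
    mu (iter n phi @^-1` E) <= A%:E * mu E.

(** The set is where some average of [u] over an initial orbit segment exceeds
    [l]; multiplying by [n] keeps [n = 0] harmless, as the strict inequality then
    fails. *)
Definition weak_type_maximal (K : R) :=
  (0 <= K)%R /\ forall (u : T -> R) (l : R), measurable_fun [set: T] u ->
    (forall x, 0 <= u x)%R -> (0 < l)%R ->
    l%:E * mu [set x | exists n, (l * n%:R < birkhoff_sum phi n u x)%R]
    <= K%:E * \int[mu]_x (u x)%:E.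

(** Integrals against the image measure are dominated by those against [k mu]. *)
Lemma integral_comp_le (k : R) (psi : T -> T) (u : T -> \bar R) : (0 <= k)%R ->
  measurable_fun [set: T] psi ->
  (forall E, measurable E -> mu (psi @^-1` E) <= k%:E * mu E) ->
  measurable_fun [set: T] u -> (forall x, 0 <= u x) ->
  \int[mu]_x u (psi x) <= k%:E * \int[mu]_x u x.
Proof.
move=> k0 mpsi hpsi mu_ u0.
have := @ge0_integral_pushforward _ _ _ _ R psi mpsi mu setT u measurableT mu_
  (fun y _ => u0 y).
rewrite preimage_setT => <-.
rewrite (_ : k%:E = (NngNum k0)%:num%:E)// -ge0_integral_mscale//.
pose nu : {measure set T -> \bar R} := pushforward mu psi.
have le_nu S : measurable S -> nu mpsi S <= mscale (NngNum k0) mu S by exact: hpsi.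
exact: (ge0_le_measure_integral le_nu measurableT u0 mu_).
Qed.

End Orbits.

Section MaximalInequality.
Context {d : measure_display} {T : measurableType d} {R : realType}.
Context (mu : {measure set T -> \bar R}).
Context (phi : T -> T).
Context (mphi : measurable_fun [set: T] phi).
Context (A : R).
Context (hA : power_bounded_by mu phi A).

Lemma integral_comp_iter_le n (u : T -> R) :
  measurable_fun [set: T] u -> (forall x, 0 <= u x)%R ->
  \int[mu]_x (u (iter n phi x))%:E <= A%:E * \int[mu]_x (u x)%:E.
Proof.
move=> mu_ u0; case: hA => A1 bA.
apply: (@integral_comp_le _ _ _ mu A (iter n phi) (EFin \o u)) => //.
- by rewrite (le_trans ler01).
- exact: measurable_iter.
- exact: bA.
- exact/measurable_EFinP.
Qed.

Lemma integral_birkhoff_sum n (u : T -> R) :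
  measurable_fun [set: T] u -> (forall x, 0 <= u x)%R ->
  \int[mu]_x (birkhoff_sum phi n u x)%:E
  = \sum_(i < n) \int[mu]_x (u (iter i phi x))%:E.
Proof.
move=> mu_ u0; rewrite -ge0_integral_sum//.
- by apply: eq_integral => x _; rewrite sumEFin.
- by move=> i; apply/measurable_EFinP; apply: measurable_comp_iter.
- by move=> i x _; rewrite lee_fin.
Qed.

Lemma integral_birkhoff_sum_le n (u : T -> R) :
  measurable_fun [set: T] u -> (forall x, 0 <= u x)%R ->
  \int[mu]_x (birkhoff_sum phi n u x)%:E <= (n%:R * A)%:E * \int[mu]_x (u x)%:E.
Proof.
move=> mu_ u0; rewrite integral_birkhoff_sum// EFinM -muleA.
apply: (@le_trans _ _ (\sum_(i < n) (A%:E * \int[mu]_x (u x)%:E))).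
  by apply: lee_sum => i _; exact: integral_comp_iter_le.
by rewrite sumr_const card_ord muleC [in leRHS]mule_natl//.
Qed.

Lemma measurable_set_gt (f : T -> R) a :
  measurable_fun [set: T] f -> measurable [set x | (a < f x)%R].
Proof.
move=> mf; rewrite (_ : [set x | _] = [set: T] `&` f @^-1` `]a, +oo[); last first.
  by rewrite setTI; apply/seteqP; split => x /=; rewrite in_itv/= andbT.
exact: mf.
Qed.

Lemma measurable_maximal_set l (u : T -> R) : measurable_fun [set: T] u ->
  measurable [set x | exists n, (l * n%:R < birkhoff_sum phi n u x)%R].
Proof.
move=> mu_; rewrite (_ : [set x | _] =
    \bigcup_n [set x | (l * n%:R < birkhoff_sum phi n u x)%R]).
  apply: bigcupT_measurable => n.
  exact/measurable_set_gt/measurable_birkhoff_sum.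
by apply/seteqP; split => x /= [n]; [exists n|move=> _ ?; exists n].
Qed.

Section Excess.
Context (u : T -> R) (l : R).
Context (mu_ : measurable_fun [set: T] u).
Context (u0 : forall x, (0 <= u x)%R).
Context (l0 : (0 <= l)%R).

Let E n := [set x | 0 < excess phi u l n x]%R.

Lemma measurable_excess_gt0 n : measurable (E n).
Proof.
exact/measurable_set_gt/measurable_excess.
Qed.

(** Finiteness makes the cancellation of the excess integrals legitimate. *)
Lemma integral_excess_fin n : \int[mu]_x (u x)%:E < +oo ->
  \int[mu]_x (excess phi u l n x)%:E < +oo.
Proof.
move=> ufin; apply: (@le_lt_trans _ _ (\int[mu]_x (birkhoff_sum phi n u x)%:E)).
  apply: ge0_le_integral => //.
  - by move=> x _; rewrite lee_fin excess_ge0.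
  - exact/measurable_EFinP/measurable_excess.
  - exact/measurable_EFinP/measurable_birkhoff_sum.
  - by move=> x _; rewrite lee_fin excess_le_birkhoff_sum.
rewrite (le_lt_trans (integral_birkhoff_sum_le n mu_ u0))//.
by rewrite lte_mul_pinfty// lee_fin mulr_ge0// (le_trans ler01)//; case: hA.
Qed.

Lemma integral_hopf n i :
  l%:E * mu (iter i phi @^-1` E n) + \int[mu]_x (excess phi u l n (iter i phi x))%:E
  <= \int[mu]_x (u (iter i phi x))%:E
     + \int[mu]_x (excess phi u l n (iter i.+1 phi x))%:E.
Proof.
have mE := measurable_excess_gt0 n.
have mEi : measurable (iter i phi @^-1` E n).
  by rewrite -[X in measurable X]setTI; exact: measurable_iter.
have mM : measurable_fun [set: T] (excess phi u l n) by exact: measurable_excess.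
rewrite -[X in mu X]setIT -integral_indic// -ge0_integralZl//; last first.
  exact/measurable_EFinP/measurable_indic.
have mI : measurable_fun [set: T]
    (fun x => l%:E * (\1_(iter i phi @^-1` E n) x : R)%:E).
  apply/measurable_EFinP; exact: measurable_funM.
rewrite -!ge0_integralD//; last 7 first.
- by move=> x _; rewrite -EFinM lee_fin mulr_ge0.
- by move=> x _; rewrite lee_fin excess_ge0.
- exact/measurable_EFinP/(measurable_comp_iter mphi i mM).
- by move=> x _; rewrite lee_fin.
- exact/measurable_EFinP/measurable_comp_iter.
- by move=> x _; rewrite lee_fin excess_ge0.
- exact/measurable_EFinP/(measurable_comp_iter mphi i.+1 mM).
apply: ge0_le_integral => //.
- by move=> x _; rewrite lee_fin addr_ge0 ?excess_ge0// mulr_ge0.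
- apply/measurable_EFinP; apply: measurable_funD.
    exact: measurable_funM.
  exact: (measurable_comp_iter mphi i mM).
- apply/measurable_EFinP; apply: measurable_funD.
    exact: measurable_comp_iter.
  exact: (measurable_comp_iter mphi i.+1 mM).
- by move=> x _; rewrite lee_fin; exact: excess_hopf.
Qed.

(** Applying Hopf's inequality at the first [L] points of the orbit telescopes the
    excess terms: only the first and the last one survive. *)
Lemma integral_hopf_sum n L :
  \sum_(i < L) (l%:E * mu (iter i phi @^-1` E n)) + \int[mu]_x (excess phi u l n x)%:E
  <= \sum_(i < L) \int[mu]_x (u (iter i phi x))%:E
     + \int[mu]_x (excess phi u l n (iter L phi x))%:E.
Proof.
elim: L => [|L IH]; first by rewrite !big_ord0.
rewrite !big_ord_recr [leLHS]addeAC -[leRHS]addeA.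
apply: (le_trans (leeD2r _ IH)); rewrite -addeA leeD2l// addeC.
exact: integral_hopf.
Qed.

End Excess.

(** It suffices to bound the sets [{excess > 0}] at each finite time: they increase
    to a set containing the one of the maximal inequality. *)
Lemma weak_type_excess (K : R) : (0 < K)%R ->
  (forall (u : T -> R) (l : R) n, measurable_fun [set: T] u -> (forall x, 0 <= u x)%R ->
    (0 < l)%R -> \int[mu]_x (u x)%:E < +oo ->
    l%:E * mu [set x | 0 < excess phi u l n x]%R <= K%:E * \int[mu]_x (u x)%:E) ->
  weak_type_maximal mu phi K.
Proof.
move=> K0 hK; split => [|u l mu_ u0 l0]; first exact: ltW.
have [->|ufin] := eqVneq (\int[mu]_x (u x)%:E) +oo.
  by rewrite gt0_muley ?lte_fin// leey.
pose E n := [set x | 0 < excess phi u l n x]%R.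
have mE n : measurable (E n) by exact: measurable_excess_gt0.
have cupE : measurable (\bigcup_n E n) by exact: bigcupT_measurable.
apply: (@le_trans _ _ (l%:E * mu (\bigcup_n E n))).
  rewrite lee_pmul2l ?lte_fin//; apply: le_measure; rewrite ?inE//.
    exact: measurable_maximal_set.
  move=> x [n hn]; exists n => //=.
  apply: lt_le_trans (excess_birkhoff_sum phi u l n x).
  by rewrite subr_gt0.
rewrite -lee_pdivlMl//.
have : mu \o E @ \oo --> mu (\bigcup_n E n).
  apply: nondecreasing_cvg_mu => //; apply/nondecreasing_seqP => n.
  apply/subsetPset => x /=; rewrite /E/= => /lt_le_trans; apply.
  exact: excess_nondecreasing.
move=> cE; rewrite -(cvg_lim _ cE)//; apply: lime_le.
  by apply/cvg_ex; eexists; exact: cE.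
near=> n; rewrite /= lee_pdivlMl//; apply: hK => //.
by rewrite ltey.
Unshelve. all: by end_near. Qed.

(** A map that does not increase measure does not increase the integral of the
    excess, so the excess terms cancel in a single step of Hopf's inequality. *)
Lemma weak_type_contraction :
  (forall E : set T, measurable E -> mu (phi @^-1` E) <= mu E) ->
  weak_type_maximal mu phi 1.
Proof.
move=> hphi; apply: weak_type_excess => // u l n mu_ u0 l0 ufin; rewrite mul1e.
have Mfin := integral_excess_fin mu_ u0 (ltW l0) n ufin.
have M0 : 0 <= \int[mu]_x (excess phi u l n x)%:E.
  by apply: integral_ge0 => x _; rewrite lee_fin excess_ge0.
have := integral_hopf mu_ u0 (ltW l0) n 0.
rewrite [iter 0 _ @^-1` _](_ : _ = [set x | 0 < excess phi u l n x]%R)//.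
have : \int[mu]_x (excess phi u l n (iter 1 phi x))%:E
    <= 1%:E * \int[mu]_x (excess phi u l n x)%:E.
  apply: (@integral_comp_le _ _ _ mu 1 phi (EFin \o excess phi u l n)) => //.
  - by move=> E mE; rewrite mul1e; exact: hphi.
  - exact/measurable_EFinP/measurable_excess.
  - by move=> x; rewrite lee_fin excess_ge0.
rewrite mul1e => le1 /le_trans/(_ (leeD2l _ le1)).
by rewrite leeD2rE// ge0_fin_numE.
Qed.

(** With [L] steps the left side is at least [L C l mu(E)], whereas the right side is
    [L A int u] up to a term independent of [L]; hence [C l mu(E) <= A int u]. *)
Lemma weak_type_bounded_below C : (0 < C)%R ->
  (forall i (E : set T), measurable E -> C%:E * mu E <= mu (iter i phi @^-1` E)) ->
  weak_type_maximal mu phi (A / C).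
Proof.
move=> C0 hC; have A0 : (0 < A)%R by apply: lt_le_trans ltr01 _; case: hA.
apply: weak_type_excess => [|u l n mu_ u0 l0 ufin]; first exact: divr_gt0.
have mE := measurable_excess_gt0 l mu_ n.
set E := [set x | 0 < excess phi u l n x]%R in mE *.
have Mfin := integral_excess_fin mu_ u0 (ltW l0) n ufin.
have M0 : 0 <= \int[mu]_x (excess phi u l n x)%:E.
  by apply: integral_ge0 => x _; rewrite lee_fin excess_ge0.
have I0 : 0 <= \int[mu]_x (u x)%:E by apply: integral_ge0 => x _; rewrite lee_fin.
have main L : (L%:R * (l * C))%:E * mu E
    <= (L%:R * A)%:E * \int[mu]_x (u x)%:E + A%:E * \int[mu]_x (excess phi u l n x)%:E.
  apply: (@le_trans _ _ (\sum_(i < L) (l%:E * mu (iter i phi @^-1` E)))).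
    rewrite EFinM -muleA -[in leLHS](card_ord L) -sum1_card natr_sum -sumEFin.
    rewrite ge0_sume_distrl//; apply: lee_sum => i _.
    by rewrite mul1e EFinM -muleA lee_pmul2l ?lte_fin//; exact: hC.
  apply: (@le_trans _ _ (\sum_(i < L) (l%:E * mu (iter i phi @^-1` E))
      + \int[mu]_x (excess phi u l n x)%:E)); first by rewrite leeDl.
  apply: (le_trans (integral_hopf_sum mu_ u0 (ltW l0) n L)); apply: leeD.
    by rewrite -integral_birkhoff_sum//; exact: integral_birkhoff_sum_le.
  apply: integral_comp_iter_le; first exact: measurable_excess.
  by move=> x; exact: excess_ge0.
have muEfin : mu E < +oo.
  rewrite ltey; apply/negP => /eqP muE; have := main 1%N.
  rewrite muE gt0_muley ?lte_fin ?mul1r ?mulr_gt0// leye_eq => /eqP h.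
  have : A%:E * \int[mu]_x (u x)%:E + A%:E * \int[mu]_x (excess phi u l n x)%:E < +oo.
    by rewrite lte_add_pinfty// lte_mul_pinfty// ?lee_fin ltW.
  by rewrite h.
move: main; rewrite -(fineK (x := mu E)) ?ge0_fin_numE//.
rewrite -(fineK (x := \int[mu]_x (u x)%:E)) ?ge0_fin_numE//.
rewrite -(fineK (x := \int[mu]_x (excess phi u l n x)%:E)) ?ge0_fin_numE//.
set e := fine _; set a := fine _; set m := fine _ => main.
rewrite -!EFinM lee_fin mulrAC ler_pdivlMr//.
rewrite leNgt; apply/negP => h.
(* If the bound failed, this many steps would violate [main]. *)
pose L := (Num.truncn (A * m / (l * e * C - A * a))%R).+1.
have := main L; rewrite -!EFinM -EFinD lee_fin.
have : (A * m / (l * e * C - A * a) < L%:R)%R by exact: Num.Theory.truncnS_gt.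
rewrite ltr_pdivrMr ?subr_gt0//; lra.
Qed.

Lemma conditionI_weak_type : conditionI mu phi ->
  exists K, weak_type_maximal mu phi K.
Proof.
move=> [_ _ [h|[C [C0 h]]]]; first by exists 1%R; exact: weak_type_contraction.
by exists (A / C)%R; exact: weak_type_bounded_below.
Qed.

End MaximalInequality.

Lemma power_measure_bounded_by {d : measure_display} {T : measurableType d}
    {R : realType} (mu : {measure set T -> \bar R}) (phi : T -> T) :
  power_measure_bounded mu phi -> exists A, power_bounded_by mu phi A.
Proof.
move=> [A [A0 hA]]; exists (Num.max 1 A)%R; split; first by rewrite le_max lexx.
move=> [|n] E mE.
  by rewrite -[leLHS]mul1e lee_wpmul2r// lee_fin le_max lexx.
by rewrite (le_trans (hA n.+1 _ _ mE))// lee_wpmul2r// lee_fin le_max lexx orbT.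
Qed.

(** * Convergence in L^1 + L^oo and sublinear growth *)

Section PointwiseErgodic.
Context {d : measure_display} {T : measurableType d} {R : realType}.
Context (mu : {measure set T -> \bar R}).

(** The exceptional sets for the accuracies [1 / n.+1] have a null intersection. *)
Lemma ae_from_small_exception (P : T -> Prop) :
  (forall e : R, (0 < e)%R -> exists M, [/\ measurable M, mu M <= e%:E &
     {ae mu, forall x, ~ M x -> P x}]) ->
  {ae mu, forall x, P x}.
Proof.
move=> small; have e0 n : (0 < n.+1%:R^-1 :> R)%R by rewrite invr_gt0.
have {small}/choice[M hM] := fun n => small _ (e0 n).
have mM n : measurable (M n) by case: (hM n).
have aeM : {ae mu, forall x, forall n, ~ M n x -> P x}.
  by apply: ae_foralln => n; case: (hM n).
have : {ae mu, forall x, ~ (\bigcap_n M n) x}.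
  exists (\bigcap_n M n); split; last by move=> x /= /contrapT.
    exact: bigcapT_measurable.
  apply/eqP; rewrite -measure_le0; apply/lee_addgt0Pr => e egt0; rewrite add0e.
  have [n ne] : exists n, (n.+1%:R^-1 < e)%R.
    have := near_infty_natSinv_lt (PosNum egt0).
    by move=> [n _ /(_ n (leqnn n))]; exists n.
  apply: (@le_trans _ _ (mu (M n))).
    apply: le_measure; rewrite ?inE//; first exact: bigcapT_measurable.
    exact: bigcap_inf.
  case: (hM n) => _ + _ => /le_trans; apply; rewrite lee_fin; exact: ltW.
apply: filterS2 aeM => x hx hcap; apply: contrapT => nP; apply: hcap => n _.
by apply: contrapT => nM; apply: nP; exact: hx nM.
Qed.

(** [tail_integral e h <= e] exhibits [h] as the sum of a function bounded by [e] and
    one of L^1-norm at most [e]; asking it eventually for every [e > 0] is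
    convergence to 0 in L^1 + L^oo. *)
Definition tail_integral (e : R) (h : T -> R) : \bar R :=
  \int[mu]_x (Num.max 0 (`|h x| - e))%:E%R.

Lemma measurable_tail (e : R) (h : T -> R) : measurable_fun [set: T] h ->
  measurable_fun [set: T] (fun x => Num.max 0 (`|h x| - e))%R.
Proof.
move=> mh; apply: measurable_maxr => //; apply: measurable_funB => //.
exact: measurableT_comp.
Qed.

Lemma tail_markov (e t : R) (h : T -> R) : measurable_fun [set: T] h ->
  (e <= t)%R ->
  (t - e)%:E * mu [set x | (t < `|h x|)%R] <= tail_integral e h.
Proof.
move=> mh et.
have mS : measurable [set x | (t < `|h x|)%R].
  by apply: measurable_set_gt; exact: measurableT_comp.
rewrite -[X in mu X]setIT -integral_indic// -ge0_integralZl//; last 2 first.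
  exact/measurable_EFinP/measurable_indic.
  by rewrite lee_fin subr_ge0.
apply: ge0_le_integral => //.
- by move=> x _; rewrite -EFinM lee_fin mulr_ge0// subr_ge0.
- by apply/measurable_EFinP; exact: measurable_funM.
- exact/measurable_EFinP/measurable_tail.
- move=> x _; rewrite -EFinM lee_fin indicE; have [|_] := boolP (x \in _).
    rewrite inE/= mulr1 le_max => tx; apply/orP; right; lra.
  by rewrite mulr0 le_max lexx.
Qed.

(** Dominated convergence: raising the level makes the tail vanish pointwise. *)
Lemma tail_integral_cvg0 (s : R) (h : T -> R) : measurable_fun [set: T] h ->
  tail_integral s h < +oo ->
  forall e : R, (0 < e)%R -> exists2 t : R, (0 <= t)%R & tail_integral t h <= e%:E.
Proof.
move=> mh hfin e e0.
pose g : T -> \bar R := fun x => (Num.max 0 (`|h x| - s))%:E%R.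
pose F : nat -> T -> \bar R := fun n x => (Num.max 0 (`|h x| - (`|s| + n%:R)))%:E%R.
have F_cvg x : F n x @[n --> \oo] --> (cst 0 x : \bar R).
  apply: cvg_near_cst; exists (Num.truncn `|h x|).+1 => // n /= hn.
  rewrite /F; congr EFin; apply/max_idPl; rewrite subr_le0.
  rewrite (le_trans (ltW (Num.Theory.truncnS_gt _)))//.
  by rewrite (@le_trans _ _ n%:R)%R ?ler_nat// lerDr.
have Fg n x : `|F n x| <= g x.
  rewrite /F /g gee0_abs lee_fin; last by rewrite le_max lexx.
  rewrite ge_max !le_max lexx/=; apply/orP; right; rewrite lerD2l lerN2.
  rewrite (le_trans (ler_norm s))//.
  by rewrite lerDl.
have ig : mu.-integrable [set: T] g.
  apply/integrableP; split; first exact/measurable_EFinP/measurable_tail.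
  rewrite (eq_integral g)// => x _; rewrite gee0_abs//.
  by rewrite lee_fin le_max lexx.
have mF n : measurable_fun [set: T] (F n) by exact/measurable_EFinP/measurable_tail.
have gfin x : setT x -> g x \is a fin_num by [].
have := dominated_cvg measurableT mF (fun x _ => F_cvg x) gfin
  ig (fun n x _ => Fg n x).
rewrite integral0 => /fine_cvgP[Ffin Fcvg0].
have /cvgrPdist_le/(_ e e0) := Fcvg0 => Fe.
have [n [nfin ne]] : exists n, (\int[mu]_x F n x) \is a fin_num /\
    (`|0 - fine (\int[mu]_x F n x)| <= e)%R.
  have [n _ H] := filterI Ffin Fe; exists n; exact: H (leqnn n).
exists (`|s| + n%:R)%R; first exact: addr_ge0.
rewrite /tail_integral -[leLHS]fineK// lee_fin (le_trans (ler_norm _))//.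
by rewrite -normrN -sub0r.
Qed.

Definition sublinear (a : nat -> R) :=
  forall l : R, (0 < l)%R -> \forall m \near \oo, (a m <= l * m%:R)%R.

Lemma sublinear_cst c : sublinear (fun=> c).
Proof.
move=> l l0; exists (Num.truncn (c / l)).+1 => // m /= hm.
rewrite mulrC -ler_pdivrMr// (le_trans (ltW (Num.Theory.truncnS_gt _)))//.
by rewrite ler_nat.
Qed.

Lemma sublinearD a b : sublinear a -> sublinear b ->
  sublinear (fun m => a m + b m)%R.
Proof.
move=> sa sb l l0; have l2 : (0 < l / 2)%R by rewrite divr_gt0.
by apply: filterS2 (sa _ l2) (sb _ l2) => m; lra.
Qed.

Lemma sublinear_shift a j : sublinear a -> sublinear (fun m => a (m + j)%N).
Proof.
move=> sa l l0; have l2 : (0 < l / 2)%R by rewrite divr_gt0.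
have [n _ hn] := sa _ l2; exists (maxn n j) => // m /=; rewrite geq_max => /andP[nm jm].
rewrite (le_trans (hn _ _)) /=; [|exact: leq_trans nm (leq_addr _ _)|].
  by [].
have : (j%:R <= m%:R :> R)%R by rewrite ler_nat.
by rewrite natrD; nra.
Qed.

Lemma sublinear_sum a n :
  sublinear a -> sublinear (fun m => \sum_(j < n) a (m + j)%N)%R.
Proof.
move=> sa; elim: n => [|n IH].
  by under [X in sublinear X]funext do rewrite big_ord0; exact: sublinear_cst.
under [X in sublinear X]funext do rewrite big_ord_recr.
by apply: sublinearD => //=; exact: sublinear_shift.
Qed.

Section Orbit.
Context (phi : T -> T).

Lemma birkhoff_sum_norm n (f : T -> R) x :
  (`|birkhoff_sum phi n f x| <= birkhoff_sum phi n (Num.norm \o f) x)%R.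
Proof. exact: ler_norm_sum. Qed.

Lemma birkhoff_sum_mono n i (u : T -> R) x : (forall y, 0 <= u y)%R ->
  (i <= n)%N -> (birkhoff_sum phi i u x <= birkhoff_sum phi n u x)%R.
Proof.
move=> u0 /subnK <-; elim: (n - i)%N => [|k IH]; first by rewrite add0n.
by rewrite addSn birkhoff_sumSr (le_trans IH)// lerDl.
Qed.

Lemma birkhoff_sum_addn m n (f : T -> R) x :
  birkhoff_sum phi (m + n) f x =
  (birkhoff_sum phi m f x + birkhoff_sum phi n f (iter m phi x))%R.
Proof.
elim: n => [|n IH]; first by rewrite addn0 birkhoff_sum0 addr0.
by rewrite addnS !birkhoff_sumSr IH addrA -iterD addnC.
Qed.

(** The two summations commute, and translating the starting point of the sum of
    length [m] by [i < n] only exchanges its [i] first terms for the [i] next ones: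
    each of these blocks is bounded by an orbit sum of length [n], from [x] or from
    [iter m phi x]. *)
Lemma birkhoff_sum_average m n (f : T -> R) x :
  (`|birkhoff_sum phi m (birkhoff_sum phi n f) x - n%:R * birkhoff_sum phi m f x|
   <= n%:R * (birkhoff_sum phi n (Num.norm \o f) x
              + birkhoff_sum phi n (Num.norm \o f) (iter m phi x)))%R.
Proof.
have -> : birkhoff_sum phi m (birkhoff_sum phi n f) x =
    (\sum_(i < n) birkhoff_sum phi m f (iter i phi x))%R.
  rewrite /birkhoff_sum exchange_big/=; apply: eq_bigr => i _.
  by apply: eq_bigr => j _; rewrite -!iterD addnC.
have -> : (n%:R * birkhoff_sum phi m f x = \sum_(i < n) birkhoff_sum phi m f x)%R.
  by rewrite sumr_const card_ord mulr_natl.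
rewrite -sumrB (le_trans (ler_norm_sum _ _ _))//.
rewrite mulr_natl -[X in (_ *+ X)%R](card_ord n) -sumr_const; apply: ler_sum => i _.
have -> : (birkhoff_sum phi m f (iter i phi x) - birkhoff_sum phi m f x
   = birkhoff_sum phi i f (iter m phi x) - birkhoff_sum phi i f x)%R.
  have := birkhoff_sum_addn m i f x; rewrite addnC birkhoff_sum_addn; lra.
have leS y : (`|birkhoff_sum phi i f y| <= birkhoff_sum phi n (Num.norm \o f) y)%R.
  rewrite (le_trans (birkhoff_sum_norm _ _ _))//.
  by apply: birkhoff_sum_mono => [z|]; [exact: normr_ge0|exact: ltnW].
by rewrite (le_trans (ler_normB _ _))// [leRHS]addrC; apply: lerD.
Qed.

End Orbit.
End PointwiseErgodic.

(** * The pointwise ergodic theorem *)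

Section PointwiseErgodicTheorem.
Context {d : measure_display} {T : measurableType d} {R : realType}.
Context (mu : {measure set T -> \bar R}).
Context (phi : T -> T).
Context (mphi : measurable_fun [set: T] phi).
Context (A : R).
Context (hA : power_bounded_by mu phi A).
Context (K : R).
Context (hK : weak_type_maximal mu phi K).

Lemma ae_comp_iter n (P : T -> Prop) :
  {ae mu, forall x, P x} -> {ae mu, forall x, P (iter n phi x)}.
Proof.
move=> [N [mN N0 PN]]; exists (iter n phi @^-1` N); split.
- by rewrite -[X in measurable X]setTI; exact: measurable_iter.
- case: hA => _ /(_ n _ mN); rewrite N0 mule0 => h.
  by apply/eqP; rewrite -measure_le0.
- by move=> x nP; apply: PN.
Qed.

(** The maximal inequality in the form used below: if the tail of [h] above [s] is
    small, its averages are bounded by [l] at all times off a set of measure at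
    most [e]. *)
Lemma exceptional_set (h : T -> R) (s l e : R) : measurable_fun [set: T] h ->
  (0 < l)%R -> (0 < e)%R -> tail_integral mu s h <= (l * e / (K + 1))%:E ->
  exists M, [/\ measurable M, mu M <= e%:E & forall x, ~ M x -> forall n,
    (birkhoff_sum phi n (fun y => Num.max 0 (`|h y| - s)) x <= l * n%:R)%R].
Proof.
(* [K + 1] is divided by because [K] may vanish. *)
move=> mh l0 e0 small; case: hK => K0 wt; pose u y := Num.max 0%R (`|h y| - s)%R.
exists [set x | exists n, (l * n%:R < birkhoff_sum phi n u x)%R].
have mtail := measurable_tail s mh; split.
- exact: measurable_maximal_set.
- rewrite -(@lee_pmul2l _ l%:E) ?lte_fin//; apply: (le_trans (wt u l _ _ _)) => //.
    by move=> x; rewrite le_max lexx.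
  apply: (le_trans (lee_wpmul2l _ small)); first by rewrite lee_fin.
  rewrite -!EFinM lee_fin mulrA ler_pdivrMr ?ltr_wpDl//; have := mulr_ge0 (ltW l0) (ltW e0).
  by lra.
- by move=> x nM n; rewrite leNgt; apply/negP => h'; apply: nM; exists n.
Qed.

Lemma sublinear_inv_nat (a : nat -> R) :
  (forall k : nat, \forall m \near \oo, (a m <= k.+1%:R^-1 * m%:R)%R) -> sublinear a.
Proof.
move=> h l l0; have [k _ /(_ k (leqnn k)) kl] := near_infty_natSinv_lt (PosNum l0).
apply: filterS (h k) => m /le_trans; apply.
by rewrite ler_wpM2r// ltW.
Qed.

Lemma ae_sublinear (a : T -> nat -> R) :
  (forall l : R, (0 < l)%R -> {ae mu, forall x, \forall m \near \oo, (a x m <= l * m%:R)%R}) ->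
  {ae mu, forall x, sublinear (a x)}.
Proof.
move=> h; have : {ae mu, forall x (k : nat),
    \forall m \near \oo, (a x m <= k.+1%:R^-1 * m%:R)%R}.
  by apply: ae_foralln => k; apply: h; rewrite invr_gt0.
by apply: filterS => x; exact: sublinear_inv_nat.
Qed.

(** The modulus at time [m] is at most [t] plus the orbit sum at time [m.+1] of the
    tail above [t]; that sum is at most [l / 4 * m.+1] off a set whose measure is
    made small by the choice of [t]. *)
Lemma ae_sublinear_orbit (f : T -> R) s : measurable_fun [set: T] f ->
  tail_integral mu s f < +oo ->
  {ae mu, forall x, sublinear (fun m => `|f (iter m phi x)|%R)}.
Proof.
move=> mf ffin; apply: ae_sublinear => l l0.
apply: ae_from_small_exception => e e0; have K0 : (0 <= K)%R by case: hK.
have l4 : (0 < l / 4)%R by rewrite divr_gt0.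
have c0 : (0 < l / 4 * e / (K + 1))%R by rewrite !divr_gt0 ?mulr_gt0 ?ltr_wpDl.
have [t t0 small] := tail_integral_cvg0 mf ffin c0.
have [M [mM Me hM]] := exceptional_set mf l4 e0 small.
exists M; split => //; apply: aeW => x /hM {}hM.
have l2 : (0 < l / 2)%R by rewrite divr_gt0.
have [n _ hn] := sublinear_cst t l2.
exists n.+1 => // m nm; have {}hn := hn m (ltnW nm).
have := hM m.+1; rewrite birkhoff_sumSr => hS.
have S0 : (0 <= birkhoff_sum phi m (fun y => Num.max 0 (`|f y| - t)) x)%R.
  by apply: birkhoff_sum_ge0 => y; rewrite le_max lexx.
have u1 : (`|f (iter m phi x)| - t <= Num.max 0 (`|f (iter m phi x)| - t))%R.
  by rewrite le_max lexx orbT.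
have m1 : (1 <= m%:R :> R)%R by rewrite ler1n (leq_trans _ nm).
have := ler_wpM2l (ltW l4) m1; move: hn hS S0 u1.
move: (birkhoff_sum _ _ _ _) (Num.max _ _) => S U hn hS S0 u1.
rewrite -[m.+1%:R]natr1 in hS; lra.
Qed.

Section Limit.
Context (f g : T -> R) (s : R).
Context (mf : measurable_fun [set: T] f).
Context (mg : measurable_fun [set: T] g).
Context (ffin : tail_integral mu s f < +oo).

Let h n x := (n%:R^-1 * birkhoff_sum phi n f x - g x)%R.

Context (h_cvg : forall e : R, (0 < e)%R ->
  \forall n \near \oo, tail_integral mu e (h n) <= e%:E).

Let mh n : measurable_fun [set: T] (h n).
Proof.
apply: measurable_funB => //; apply: measurable_funM => //.
exact: measurable_birkhoff_sum.
Qed.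

(** [g o phi - g] differs from [h_n - h_n o phi] by [(f o phi^n - f) / n], and each of
    the four terms is small in measure: composing with an iterate of [phi] costs at
    most the factor [A]. *)
Lemma limit_invariant : {ae mu, forall x, g (phi x) = g x}.
Proof.
suff H : forall l : R, (0 < l)%R -> {ae mu, forall x, (`|g (phi x) - g x| <= l)%R}.
  have : {ae mu, forall x, forall k : nat, (`|g (phi x) - g x| <= k.+1%:R^-1)%R}.
    by apply: ae_foralln => k; apply: H; rewrite invr_gt0.
  apply: filterS => x hx; apply/eqP; rewrite -subr_eq0 -normr_le0.
  apply/ler_addgt0Pr => e e0; rewrite add0r.
  have [k _ /(_ k (leqnn k)) ke] := near_infty_natSinv_lt (PosNum e0).
  exact: le_trans (hx k) (ltW ke).
move=> l l0; apply: ae_from_small_exception => e e0.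
case: hA => A1 bA; have A0 : (0 < A)%R by lra.
pose c := (e / (4 * A))%R; have c0 : (0 < c)%R by rewrite divr_gt0 ?mulr_gt0.
have [t t0 ft] := tail_integral_cvg0 mf ffin c0.
(* Since [l / 4 - eta >= l / 8], Chebyshev's inequality above [eta] turns a tail of
   integral at most [l / 8 * c] into a set of measure at most [c]. *)
pose eta := Num.min (l / 8)%R (l / 8 * c)%R.
have l8 : (0 < l / 8)%R by rewrite divr_gt0.
have eta0 : (0 < eta)%R by rewrite lt_min l8 mulr_gt0.
have l4 : (0 < l / 4)%R by rewrite divr_gt0.
have [n [n1 hn tn]] : exists n, [/\ (0 < n)%N, tail_integral mu eta (h n) <= eta%:E &
    (t + 1 <= l / 4 * n%:R)%R].
  have [n _ H] := filterI (filterI (h_cvg eta0) (sublinear_cst (t + 1)%R l4))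
    (nbhs_infty_ge 1%N).
  by have [[? ?] ?] := H n (leqnn n); exists n.
have n0 : (0 < n%:R :> R)%R by rewrite ltr0n.
pose U := [set x | (l / 4 < `|h n x|)%R].
pose V := [set x | (l / 4 * n%:R < `|f x|)%R].
have mU : measurable U by apply: measurable_set_gt; exact: measurableT_comp.
have mV : measurable V by apply: measurable_set_gt; exact: measurableT_comp.
have Uc : mu U <= c%:E.
  have etal : (eta <= l / 8)%R by rewrite ge_min lexx.
  have etac : (eta <= l / 8 * c)%R by rewrite ge_min lexx orbT.
  have : (l / 8)%:E * mu U <= (l / 8 * c)%:E.
    apply: (@le_trans _ _ ((l / 4 - eta)%:E * mu U)).
      by rewrite lee_wpmul2r// lee_fin; lra.
    apply: (le_trans (tail_markov mu (mh n) _)); first lra.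
    by rewrite (le_trans hn).
  by rewrite (EFinM (l / 8)) lee_pmul2l// lte_fin.
have Vc : mu V <= c%:E.
  apply: (@le_trans _ _ ((l / 4 * n%:R - t)%:E * mu V)).
    by rewrite -[leLHS]mul1e lee_wpmul2r// lee_fin; lra.
  by apply: (le_trans (tail_markov mu mf _)) => //; lra.
have mpre i W : measurable W -> measurable (iter i phi @^-1` W).
  by move=> mW; rewrite -[X in measurable X]setTI; exact: measurable_iter.
have pre i W : measurable W -> mu W <= c%:E -> mu (iter i phi @^-1` W) <= (e / 4)%:E.
  move=> mW Wc; apply: (le_trans (bA i W mW)).
  apply: (le_trans (lee_wpmul2l _ Wc)); first by rewrite lee_fin ltW.
  have -> : (e / 4 = A * c)%R by rewrite /c; field; rewrite gt_eqF.
  by rewrite -EFinM.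
exists ((iter 0 phi @^-1` U `|` iter 1 phi @^-1` U) `|`
        (iter 0 phi @^-1` V `|` iter n phi @^-1` V)); split.
- by do 2 apply: measurableU; apply: mpre.
- have e4 : e%:E = (e / 4)%:E + (e / 4)%:E + ((e / 4)%:E + (e / 4)%:E).
    by rewrite -!EFinD; congr EFin; lra.
  have mUU X Y : measurable X -> measurable Y -> mu (X `|` Y) <= mu X + mu Y.
    exact: measureU2.
  rewrite e4; apply: (le_trans (mUU _ _ _ _)); try by apply: measurableU; apply: mpre.
  by apply: leeD; apply: (le_trans (mUU _ _ _ _)); try (exact: mpre); apply: leeD; apply: pre.
apply: aeW => x nM.
have hx : (`|h n x| <= l / 4)%R by rewrite leNgt; apply/negP => H; apply: nM; left; left.
have hpx : (`|h n (phi x)| <= l / 4)%R.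
  by rewrite leNgt; apply/negP => H; apply: nM; left; right.
have fx : (`|f x| <= l / 4 * n%:R)%R.
  by rewrite leNgt; apply/negP => H; apply: nM; right; left.
have fnx : (`|f (iter n phi x)| <= l / 4 * n%:R)%R.
  by rewrite leNgt; apply/negP => H; apply: nM; right; right.
have -> : (g (phi x) - g x = h n x - h n (phi x) + n%:R^-1 * (f (iter n phi x) - f x))%R.
  rewrite /h; have := birkhoff_sumSl phi n f x; rewrite birkhoff_sumSr => /eqP.
  rewrite -subr_eq0 => /eqP S0.
  have -> : (f (iter n phi x) - f x =
      birkhoff_sum phi n f (phi x) - birkhoff_sum phi n f x)%R by lra.
  by rewrite mulrBr; lra.
rewrite (le_trans (ler_normD _ _))// (le_trans (lerD (ler_normB _ _) (lexx _)))//.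
rewrite normrM normfV (ger0_norm (ltW n0)).
have : (n%:R^-1 * `|f (iter n phi x) - f x| <= l / 2)%R.
  rewrite ler_pdivrMl// (le_trans (ler_normB _ _))//; lra.
lra.
Qed.

(** Once [g] is invariant, [S_m f - m g = S_m h_n - (S_m (A_n f) - S_m f)] for the
    orbit sums [S_m]. The bracket is sublinear in [m] along almost every orbit, and
    the maximal inequality for the tail of [h_n] bounds [S_m h_n] by [l / 2 * m] off
    a small set, for all [m] at once. *)
Theorem pointwise_ergodic :
  {ae mu, forall x, (n%:R^-1 * birkhoff_sum phi n f x)%R @[n --> \oo] --> g x}.
Proof.
have K0 : (0 <= K)%R by case: hK.
have ginv : {ae mu, forall x i, g (iter i phi x) = g x}.
  have : {ae mu, forall x i, g (phi (iter i phi x)) = g (iter i phi x)}.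
    by apply: ae_foralln => i; exact: (ae_comp_iter i limit_invariant).
  by apply: filterS => x hx; elim=> //= i IH; rewrite hx.
have forb := ae_sublinear_orbit mf ffin.
suff : {ae mu, forall x, sublinear (fun m => `|birkhoff_sum phi m f x - m%:R * g x|%R)}.
  apply: filterS => x hx; apply/cvgrPdist_le => l l0.
  apply: filterS2 (hx l l0) (nbhs_infty_ge 1%N) => m hm m1.
  have m0 : (0 < m%:R :> R)%R by rewrite ltr0n.
  have -> : (g x - m%:R^-1 * birkhoff_sum phi m f x =
      - (m%:R^-1 * (birkhoff_sum phi m f x - m%:R * g x)))%R.
    by field; rewrite gt_eqF.
  by rewrite normrN normrM normfV (ger0_norm (ltW m0)) ler_pdivrMl// [leRHS]mulrC.
apply: ae_sublinear => l l0; apply: ae_from_small_exception => e e0.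
have l4 : (0 < l / 4)%R by rewrite divr_gt0.
have c0 : (0 < l / 4 * e / (K + 1))%R by rewrite !divr_gt0 ?mulr_gt0 ?ltr_wpDl.
set c := (l / 4 * e / (K + 1))%R in c0.
have eta0 : (0 < Num.min c (l / 4))%R by rewrite lt_min c0 l4.
have [n [n1 hn]] : exists n, (0 < n)%N /\
    tail_integral mu (Num.min c (l / 4))%R (h n) <= (Num.min c (l / 4))%:E%R.
  have [n _ H] := filterI (h_cvg eta0) (nbhs_infty_ge 1%N).
  by have [? ?] := H n (leqnn n); exists n.
set eta := Num.min c (l / 4)%R in eta0 hn.
have n0 : (0 < n%:R :> R)%R by rewrite ltr0n.
have small : tail_integral mu eta (h n) <= c%:E.
  by rewrite (le_trans hn)// lee_fin ge_min lexx.
have etal : (eta <= l / 4)%R by rewrite ge_min lexx orbT.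
have [M [mM Me hM]] := exceptional_set (mh n) l4 e0 small.
exists M; split => //; apply: filterS2 ginv forb => x gx fx /hM {}hM.
pose w y := birkhoff_sum phi n (Num.norm \o f) y.
have wsub : sublinear (fun m => w x + w (iter m phi x))%R.
  apply: sublinearD; first exact: sublinear_cst.
  rewrite (_ : (fun m => _) = (fun m => \sum_(j < n) `|f (iter (m + j) phi x)|)%R).
    exact: (sublinear_sum n fx).
  by apply/funext => m; apply: eq_bigr => j _; rewrite /= addnC iterD.
have l2 : (0 < l / 2)%R by rewrite divr_gt0.
apply: filterS (wsub _ l2) => m hm.
have Sh : (birkhoff_sum phi m (h n) x =
    n%:R^-1 * birkhoff_sum phi m (birkhoff_sum phi n f) x - m%:R * g x)%R.
  rewrite /birkhoff_sum /h sumrB -mulr_sumr; congr (_ - _)%R.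
  under eq_bigr do rewrite gx.
  by rewrite sumr_const card_ord mulr_natl.
have Shle : (`|birkhoff_sum phi m (h n) x| <= l / 2 * m%:R)%R.
  rewrite (le_trans (birkhoff_sum_norm _ _ _ _))//.
  apply: (@le_trans _ _ (eta * m%:R +
      birkhoff_sum phi m (fun y => Num.max 0 (`|h n y| - eta)) x)%R).
    rewrite /birkhoff_sum [(eta * _)%R]mulrC mulr_natl -[X in (_ *+ X)%R](card_ord m).
    rewrite -sumr_const -big_split; apply: ler_sum => i _ /=.
    by rewrite -lerBlDl le_max lexx orbT.
  have := hM m; have := ler_wpM2r (ler0n R m) etal; lra.
have Aw : (`|n%:R^-1 * birkhoff_sum phi m (birkhoff_sum phi n f) x
    - birkhoff_sum phi m f x| <= w x + w (iter m phi x))%R.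
  rewrite -(ler_pM2l n0) -[X in (X * `|_|)%R](ger0_norm (ltW n0)) -normrM mulrBr.
  rewrite mulrA mulfV ?gt_eqF// mul1r.
  exact: birkhoff_sum_average.
rewrite (_ : birkhoff_sum phi m f x - m%:R * g x = birkhoff_sum phi m (h n) x -
    (n%:R^-1 * birkhoff_sum phi m (birkhoff_sum phi n f) x - birkhoff_sum phi m f x))%R.
  by rewrite (le_trans (ler_normB _ _))//; lra.
by rewrite Sh; lra.
Qed.

End Limit.
End PointwiseErgodicTheorem.

(** * Convergence and measurability for extended complex values *)

Section ExtendedComplexTopology.
Context {R : realType}.
Local Notation normc := (@ComplexField.Normc.normc R).

(** The balls of the regular module have radii in [R[i]], whose positive elements
    are the positive reals. *)
Lemma normcB_lt_nbhs (z : R[i]^o) (U : set R[i]^o) :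
  nbhs z U <-> exists2 e : R, (0 < e)%R & [set w : R[i]^o | normc (w - z) < e]%R `<=` U.
Proof.
split.
  rewrite -nbhs_ballE => -[e /= e0 eU]; exists (complex.Re e).
    by move: e0; rewrite ltcE => /andP[].
  move=> w /= wz; apply: eU; rewrite -ball_normE /= distrC.
  move: e0 wz; rewrite !ltcE /= => /andP[/eqP Ie _] wz.
  by rewrite Ie eqxx.
move=> [e e0 eU]; rewrite -nbhs_ballE; exists (real_complex R e).
  by rewrite /= ltcR.
move=> w; rewrite -ball_normE /= distrC ltcR => ?; exact: eU.
Qed.

Lemma xfin_cvg (u : nat -> R[i]) (z : R[i]) :
  (normc (u n - z) @[n --> \oo] --> 0)%R ->
  xfin (u n) @[n --> \oo] --> xfin z.
Proof.
move=> uz; have zU : (u n : R[i]^o) @[n --> \oo] --> (z : R[i]^o).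
  move=> U /normcB_lt_nbhs[e e0 eU].
  move/cvgrPdist_lt : uz => /(_ e e0); apply: filterS => n; rewrite sub0r normrN => h.
  by apply: eU => /=; exact: le_lt_trans (ler_norm _) h.
have := @one_point_compactification_some_continuous R[i]^o z; exact: cvg_comp.
Qed.

Lemma Re_le_normc (w : R[i]) : (`|complex.Re w| <= normc w)%R.
Proof. by have := normc_ge_Re w; rewrite normc_def lecR; case: w. Qed.

Lemma Im_le_normc (w : R[i]) : (`|complex.Im w| <= normc w)%R.
Proof.
case: w => a b /=; rewrite -sqrtr_sqr ler_wsqrtr// lerDr; exact: sqr_ge0.
Qed.

Lemma normc_le_ReIm (w : R[i]) : (normc w <= `|complex.Re w| + `|complex.Im w|)%R.
Proof.
case: w => a b /=.
rewrite -[leRHS]ger0_norm ?addr_ge0// -sqrtr_sqr ler_wsqrtr//.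
rewrite -(real_normK (num_real a)) -(real_normK (num_real b)) sqrrD addrAC lerDl.
by rewrite mulrn_wge0// mulr_ge0.
Qed.

Lemma normc_real (r : R) : normc (real_complex R r) = `|r|%R.
Proof. by rewrite /= expr0n addr0 sqrtr_sqr. Qed.

Lemma lipschitz_continuous (P : R[i]^o -> R) :
  (forall z w, `|P z - P w| <= normc (z - w))%R -> continuous P.
Proof.
move=> hP z U /nbhs_ballP[e /= e0 eU]; apply/normcB_lt_nbhs; exists e => // w /= wz.
by apply: eU; rewrite /ball/= distrC; exact: le_lt_trans (hP _ _) wz.
Qed.

Lemma Re_continuous : continuous (@complex.Re R : R[i]^o -> R).
Proof.
by apply: lipschitz_continuous => z w; have := Re_le_normc (z - w)%R; rewrite raddfB.
Qed.

Lemma Im_continuous : continuous (@complex.Im R : R[i]^o -> R).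
Proof.
by apply: lipschitz_continuous => z w; have := Im_le_normc (z - w)%R; rewrite raddfB.
Qed.

Lemma normc_continuous : continuous (normc : R[i]^o -> R).
Proof.
apply: lipschitz_continuous => z w.
have tri (a b : R[i]) : (normc a <= normc (a - b) + normc b)%R.
  by have := le_normcD ((a - b)%R : Rcomplex R) (b : Rcomplex R); rewrite subrK.
have wz : normc (w - z)%R = normc (z - w)%R.
  by rewrite -(normcN ((z - w)%R : Rcomplex R)) opprB.
rewrite ler_norml; apply/andP; split; last by have := tri z w; lra.
by have := tri w z; rewrite wz; lra.
Qed.

Lemma real_complex_continuous : continuous (real_complex R : R -> R[i]^o).
Proof.
move=> r U /normcB_lt_nbhs[e e0 eU]; apply/nbhs_ballP; exists e => // s.
rewrite /ball/= distrC => rs; apply: eU => /=.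
by move: rs; rewrite -normc_real rmorphB; apply.
Qed.

End ExtendedComplexTopology.

Section XMeasurable.
Context {d : measure_display} {T : measurableType d} {R : realType}.
Implicit Types f g : T -> xcomplex R.

Let borel := g_sigma_algebraType (@open (xcomplex R)).

Lemma measurable_xfin_image (U : set R[i]^o) :
  open U -> measurable (Some @` U : set borel).
Proof.
move=> oU; apply: sub_sigma_algebra.
exact: (@one_point_compactification_open_some R[i]^o).
Qed.

(** A strict superlevel set is the image of an open set of finite values, together
    with the closed point oo when [c] is above the level. *)
Lemma measurable_xlift (P : R[i]^o -> R) (c : \bar R) f : continuous P ->
  xmeasurable f ->
  measurable_fun [set: T] (fun x => if f x is Some w then (P w)%:E else c).
Proof.
move=> cP mf.
pose F (z : borel) : \bar R := if z is Some w then (P w)%:E else c.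
suff mF : measurable_fun [set: borel] F by exact: (measurableT_comp mF mf).
apply: (@measurability _ _ _ _ _ _ (@ErealGenOInfty.G R)).
  exact: ErealGenOInfty.measurableE.
move=> _ [_ [y ->] <-]; rewrite setTI.
have -> : F @^-1` `]y%:E, +oo[%classic =
    (Some @` [set w : R[i]^o | (y < P w)%R]) `|`
    (if y%:E < c then ~` (Some @` [set: R[i]^o]) else set0).
  apply/seteqP; split => -[w|] /=; rewrite in_itv/= andbT ?lte_fin.
  - by move=> yw; left; exists w.
  - by move=> yc; right; rewrite yc => -[].
  - by case=> [[? yw [<-]]//|]; case: ifP => // _ h; exfalso; apply: h; exists w.
  - by case=> [[]//|]; case: ifP.
apply: measurableU.
  apply: measurable_xfin_image.
  rewrite (_ : [set w | _] = P @^-1` `]y, +oo[%classic); last first.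
    by apply/seteqP; split => w /=; rewrite in_itv/= andbT.
  by apply: open_comp => // w _; exact: cP.
case: ifP => // _; apply: measurableC; apply: measurable_xfin_image; exact: openT.
Qed.

Lemma measurable_xmod f : xmeasurable f -> measurable_fun [set: T] (xmod \o f).
Proof. exact/measurable_xlift/normc_continuous. Qed.

(** The value at oo is arbitrary: it is only met on null sets. *)
Definition xpart (P : R[i] -> R) (z : xcomplex R) : R := if z is Some w then P w else 0%R.

Lemma measurable_xpart (P : R[i]^o -> R) f : continuous P -> xmeasurable f ->
  measurable_fun [set: T] (xpart P \o f).
Proof.
move=> cP mf; apply/measurable_EFinP.
rewrite (_ : EFin \o _ = fun x => if f x is Some w then (P w)%:E else 0).
  exact: measurable_xlift.
by apply/funext => x /=; case: (f x).
Qed.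

(** The real axis is embedded continuously in the sphere. A modulus that is
    measurable as an extended real function is therefore also measurable as an
    element of M, to which resonance applies. *)
Lemma xmeasurable_xpos (u : T -> \bar R) :
  measurable_fun [set: T] u -> xmeasurable (xpos \o u).
Proof.
move=> mu_; suff mF : measurable_fun [set: \bar R] (xpos : _ -> borel).
  exact: (measurableT_comp mF mu_).
apply: (@measurability _ _ (\bar R) borel setT xpos (@open (xcomplex R))) => //.
move=> _ [U oU <-]; rewrite setTI.
have -> : xpos @^-1` U =
    (EFin @` [set r : R | U (xfin (real_complex R r))]) `|`
    [set y | (y = +oo \/ y = -oo) /\ U xinfty].
  apply/seteqP; split => -[r||] /=.
  - by move=> Ur; left; exists r.
  - by move=> Ur; right; split => //; left.
  - by move=> Ur; right; split => //; right.
  - by case=> [[s Us [<-]]//|[[]]].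
  - by case=> [[]//|[]].
  - by case=> [[]//|[]].
apply: measurableU.
  apply: measurable_image_EFin; apply: open_measurable.
  have oV : open (Some @^-1` U : set R[i]^o).
    apply: (@open_comp R[i]^o (xcomplex R) Some U) => // z _.
    exact: (@one_point_compactification_some_continuous R[i]^o).
  apply: (@open_comp R R[i]^o (real_complex R) _ _ oV) => r _.
  exact: real_complex_continuous.
have [Ui|nUi] := pselect (U xinfty).
  rewrite (_ : [set y | _] = [set +oo] `|` [set -oo]).
    exact: measurableU.
  by apply/seteqP; split => y /=; [case|].
rewrite (_ : [set y | _] = set0) //.
by apply/seteqP; split => y //= [].
Qed.

Lemma xmod_xpos (y : \bar R) : 0 <= y -> xmod (xpos y) = y.
Proof.
case: y => [r| |]//; rewrite lee_fin /= => r0; congr EFin.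
by rewrite -[RHS]ger0_norm// -normc_real.
Qed.

Lemma xmod_ge0 (z : xcomplex R) : 0 <= xmod z.
Proof. by case: z => [[a b]|] //=; rewrite lee_fin sqrtr_ge0. Qed.

(** The modulus of a difference is computed from real and imaginary parts, which
    avoids the product sigma-algebra on the Riemann sphere. *)
Lemma measurable_xsub f g : xmeasurable f -> xmeasurable g ->
  measurable_fun [set: T] (fun x => xmod (xsub (f x) (g x))).
Proof.
move=> mf mg.
pose dR := fun x => (xpart (@complex.Re R) (f x) - xpart (@complex.Re R) (g x))%R.
pose dI := fun x => (xpart (@complex.Im R) (f x) - xpart (@complex.Im R) (g x))%R.
have mdR : measurable_fun [set: T] dR.
  by apply: measurable_funB; apply: measurable_xpart => //; exact: Re_continuous.
have mdI : measurable_fun [set: T] dI.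
  by apply: measurable_funB; apply: measurable_xpart => //; exact: Im_continuous.
(* The first two summands are oo where [f] or [g] is, and vanish elsewhere. *)
pose inf (k : T -> xcomplex R) (x : T) : \bar R := if k x is Some _ then 0 else +oo.
rewrite (_ : (fun x => _) = fun x =>
    inf f x + inf g x + (Num.sqrt (dR x ^+ 2 + dI x ^+ 2))%:E%R); last first.
  apply/funext => x; rewrite /inf /dR /dI.
  have n10 : (-1 == 0 :> R[i])%R = false by rewrite oppr_eq0 oner_eq0.
  case: (f x) => [[a b]|]; case: (g x) => [[a' b']|]//=; rewrite ?n10//=.
  by rewrite !add0e; congr (Num.sqrt _)%:E; ring.
have cst0 : continuous ((fun=> 0%R) : R[i]^o -> R) by exact: cst_continuous.
apply: emeasurable_funD.
  by apply: emeasurable_funD; exact: (measurable_xlift +oo cst0).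
apply/measurable_EFinP.
have mS : measurable_fun [set: T] (fun x => dR x ^+ 2 + dI x ^+ 2)%R.
  by apply: measurable_funD; apply: measurable_funX.
exact: (measurableT_comp (continuous_measurable_fun (@sqrt_continuous R)) mS).
Qed.

End XMeasurable.

(** * Rearrangements *)

(** The integral of a nonnegative function is a supremum over the simple functions
    below it, hence monotone without measurability; this spares the measurability
    of rearrangements. *)
Lemma ge0_le_integral_nonmeasurable {d : measure_display} {T : measurableType d}
    {R : realType} (nu : {measure set T -> \bar R}) (u v : T -> \bar R) (D : set T) :
  (forall t, D t -> 0 <= u t) -> (forall t, D t -> u t <= v t) ->
  \int[nu]_(t in D) u t <= \int[nu]_(t in D) v t.
Proof.
move=> u0 uv.
have v0 t : D t -> 0 <= v t by move=> Dt; exact: le_trans (u0 t Dt) (uv t Dt).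
rewrite !ge0_integralE//; apply: ereal_sup_le => _ [h /= hu <-].
exists h => //= t; rewrite (le_trans (hu t))// /patch.
by case: ifPn => // /set_mem; exact: uv.
Qed.

Section Rearrangements.
Context {d : measure_display} {T : measurableType d} {R : realType}.
Context (mu : {measure set T -> \bar R}).
Implicit Types (f g h : T -> xcomplex R) (E : set T).

Definition xindic E : T -> xcomplex R := fun x => xpos (\1_E x)%:E.

Lemma xmod_xindic E x : xmod (xindic E x) = (\1_E x)%:E.
Proof. by rewrite /xindic xmod_xpos// lee_fin. Qed.

Lemma xmeasurable_xindic E : measurable E -> xmeasurable (xindic E).
Proof.
move=> mE; apply: (xmeasurable_xpos (u := fun x => (\1_E x)%:E)).
exact/measurable_EFinP/measurable_indic.
Qed.

Lemma distribution_function_xindic E (s : R) : (0 <= s)%R ->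
  distribution_function mu (xindic E) s = if (s < 1)%R then mu E else 0.
Proof.
move=> s0; rewrite /distribution_function; have [s1|s1] := ltP s 1%R.
  congr (mu _); apply/seteqP; split => x; rewrite /mkset xmod_xindic lte_fin indicE.
    by case: (boolP (x \in E)) => [/set_mem//|_]; rewrite ltNge s0.
  by move=> /mem_set ->.
rewrite (_ : [set x | _] = set0) ?measure0//; apply/seteqP; split => x //.
rewrite /mkset xmod_xindic lte_fin indicE => sx.
by have := lt_le_trans sx (_ : _ <= 1)%R; rewrite ltNge s1 lern1; case: (x \in E) => /(_ isT).
Qed.

Lemma rearrangement_ge0 f t : 0 <= rearrangement mu f t.
Proof. by apply: le_ereal_inf_tmp => _ [s [s0 _] <-]; rewrite lee_fin. Qed.

Lemma le_rearrangement f g t :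
  (forall s : R, (0 <= s)%R -> distribution_function mu f s <= distribution_function mu g s) ->
  rearrangement mu f t <= rearrangement mu g t.
Proof.
move=> fg; apply: ereal_inf_le_tmp => _ [s [s0 gs] <-]; exists s => //.
by split => //; exact: le_trans (fg s s0) gs.
Qed.

Lemma rearrangement_ge f (e t : R) :
  (forall s : R, (0 <= s)%R -> (s < e)%R -> t%:E < distribution_function mu f s) ->
  e%:E <= rearrangement mu f t.
Proof.
move=> he; apply: le_ereal_inf_tmp => _ [s [s0 fs] <-]; rewrite lee_fin leNgt.
by apply/negP => /(he s s0); rewrite ltNge fs.
Qed.

Lemma measurable_xmod_gt f (s : R) : measurable_fun [set: T] (xmod \o f) ->
  measurable [set x | s%:E < xmod (f x)].
Proof.
move=> mf; have := mf measurableT _ (emeasurable_itv `]s%:E, +oo[).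
rewrite setTI; congr measurable; apply/seteqP; split => x /=.
  by rewrite in_itv/= andbT.
by rewrite in_itv/= andbT.
Qed.

Lemma rearrangement_xabs f : rearrangement mu (xabs f) = rearrangement mu f.
Proof.
apply/funext => t; rewrite /rearrangement /distribution_function.
have E s : [set x | s%:E < xmod (xabs f x)] = [set x | s%:E < xmod (f x)].
  by apply/seteqP; split => x /=; rewrite /xabs xmod_xpos// xmod_ge0.
by congr (ereal_inf [set _ | _ in _]); apply/seteqP; split => s /= []; rewrite E.
Qed.

Lemma le_rearrangement_pairing f f' g :
  (forall t, rearrangement mu f t <= rearrangement mu f' t) ->
  rearrangement_pairing mu f g <= rearrangement_pairing mu f' g.
Proof.
move=> ff'; apply: ge0_le_integral_nonmeasurable => t _.
  by rewrite mule_ge0// rearrangement_ge0.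
by rewrite lee_wpmul2r// rearrangement_ge0.
Qed.

(** [g] itself is one of the competitors in the supremum that defines resonance. *)
Lemma hardy_littlewood f g : resonant mu -> xmeasurable f -> xmeasurable g ->
  \int[mu]_x (xmod (f x) * xmod (g x)) <= rearrangement_pairing mu f g.
Proof.
move=> [_ hres] mf mg; rewrite -hres//; apply: ereal_sup_ubound.
by exists g.
Qed.

(** If [{|h| > e}] had measure greater than [mu E], then [h^*] would be at least [e] on
    all of [0, mu E), where the rearrangement of the indicator is 1. *)
Lemma pairing_xindic_small E h (e : R) : measurable E -> mu E < +oo ->
  measurable_fun [set: T] (xmod \o h) -> (0 <= e)%R ->
  rearrangement_pairing mu (xindic E) h < e%:E * mu E ->
  distribution_function mu h e <= mu E.
Proof.
move=> mE Efin mh e0; apply: contraTT; rewrite -!leNgt -ltNge => hE.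
have muE : mu E = (fine (mu E))%:E by rewrite fineK// ge0_fin_numE.
set c := fine (mu E) in muE; have c0 : (0 <= c)%R by rewrite fine_ge0.
have -> : e%:E * mu E =
    \int[lebesgue_measure]_(t in `[0%R, +oo[%classic) (e%:E * (\1_(`[0%R, c[%classic) t)%:E).
  rewrite ge0_integralZl//; last exact/measurable_EFinP/measurable_indic.
  rewrite integral_indic//= setIidl ?lebesgue_measure_itv/=; last first.
    by apply: subset_itvl; rewrite bnd_simp.
  rewrite lte_fin muE; case: ltP => [_|]; first by rewrite sube0.
  by rewrite le_eqVlt ltNge c0 orbF => /eqP ->.
apply: ge0_le_integral_nonmeasurable => t /=; rewrite in_itv/= andbT => t0.
  by rewrite -EFinM lee_fin mulr_ge0.
rewrite indicE; have [|_] := boolP (t \in _); last first.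
  by rewrite mule0 mule_ge0// rearrangement_ge0.
rewrite inE/= in_itv/= t0/= => tc; rewrite mule1 -[leLHS]mul1e.
apply: lee_pmul => //; apply: rearrangement_ge => s s0 s1.
  by rewrite distribution_function_xindic// s1 muE lte_fin.
apply: (@lt_le_trans _ _ (distribution_function mu h e)).
  by rewrite (le_lt_trans _ hE)// muE lee_fin ltW.
apply: le_measure; rewrite ?inE; try exact: measurable_xmod_gt.
by move=> x /=; apply: lt_trans; rewrite lte_fin.
Qed.

(** The set [F] where [|h| > e] has measure at most [mu E], so the rearrangement
    of its indicator is below that of the indicator of [E]; Hardy-Littlewood
    applied to [F] concludes. *)
Lemma pairing_xindic_integral E h (e : R) : resonant mu ->
  measurable E -> mu E < +oo ->
  measurable_fun [set: T] (xmod \o h) -> (0 <= e)%R ->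
  rearrangement_pairing mu (xindic E) h < e%:E * mu E ->
  \int[mu]_(x in [set x | e%:E < xmod (h x)]) xmod (h x)
  <= rearrangement_pairing mu (xindic E) h.
Proof.
move=> hres mE Efin mh e0 small; set F := [set x | _].
have mF : measurable F by exact: measurable_xmod_gt.
have FE : mu F <= mu E by exact: pairing_xindic_small.
have -> : \int[mu]_(x in F) xmod (h x) =
    \int[mu]_x (xmod (xindic F x) * xmod (xabs h x)).
  rewrite integral_mkcond; apply: eq_integral => x _.
  rewrite xmod_xindic /xabs xmod_xpos ?xmod_ge0// /patch indicE.
  by case: ifPn => _; rewrite ?mul1e ?mul0e.
have mxh : xmeasurable (xabs h) by exact: (xmeasurable_xpos mh).
apply: (le_trans (hardy_littlewood hres (xmeasurable_xindic mF) mxh)).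
rewrite /rearrangement_pairing rearrangement_xabs.
apply: le_rearrangement_pairing => t; apply: le_rearrangement => s s0.
by rewrite !distribution_function_xindic//; case: ifP.
Qed.

(** Real and imaginary parts inherit their tails from the modulus. *)
Lemma tail_integral_le (k : T -> \bar R) (q : T -> R) (e : R) :
  measurable_fun [set: T] k -> (forall x, 0 <= k x) ->
  measurable_fun [set: T] q -> (0 <= e)%R ->
  {ae mu, forall x, (`|q x|%:E <= k x)%E} ->
  tail_integral mu e q <= \int[mu]_(x in [set x | e%:E < k x]) k x.
Proof.
move=> mk k0 mq e0 qk; rewrite integral_mkcond.
have mS : measurable [set x | e%:E < k x].
  have := mk measurableT _ (emeasurable_itv `]e%:E, +oo[).
  by rewrite setTI; congr measurable; apply/seteqP; split => x /=;
    rewrite in_itv/= andbT.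
apply: ae_ge0_le_integral => //.
- by move=> x _; rewrite lee_fin le_max lexx.
- exact/measurable_EFinP/measurable_tail.
- by move=> x _; exact: erestrict_ge0.
- apply/(measurable_restrictT _ _).1 => //; exact: measurable_funTS.
- apply: filterS qk => x qk _; rewrite /patch; case: ifPn => [_|].
    apply: le_trans qk; rewrite lee_fin ge_max normr_ge0 lerBlDr lerDl e0//.
  rewrite notin_setE /= => /negP; rewrite -leNgt => ke.
  have := le_trans qk ke; rewrite lee_fin => qe.
  by rewrite lee_fin ge_max lexx subr_le0.
Qed.

End Rearrangements.

(** * Function norms and the topology xi *)

Section FunctionSpaceFacts.
Context {d : measure_display} {T : measurableType d} {R : realType}.
Context (mu : {measure set T -> \bar R}).
Context (N : (T -> xcomplex R) -> \bar R).
Context (hN : banach_function_norm mu N).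
Implicit Types (f g : T -> xcomplex R) (E : set T).

Lemma nonneg_measurable_xmod f :
  xmeasurable f -> nonneg_measurable (xmod \o f).
Proof. by move=> mf; split; [exact: measurable_xmod|move=> x; exact: xmod_ge0]. Qed.

(** This is (P5), which bounds the integral over [E] by the norm. *)
Lemma associate_xindic E : measurable E -> mu E < +oo ->
  function_space (associate_norm mu N) (xindic E).
Proof.
move=> mE Efin; split; first exact: xmeasurable_xindic.
have [C hC] := bfn_integral hN mE Efin.
apply: (@le_lt_trans _ _ `|C|%:E); last exact: ltry.
apply: ge_ereal_sup => _ [g [mg Ng1] <-].
have -> : \int[mu]_x (xmod (xindic E x) * xmod (g x)) = \int[mu]_(x in E) xmod (g x).
  rewrite [RHS]integral_mkcond; apply: eq_integral => x _.
  by rewrite xmod_xindic /patch indicE; case: ifPn => _; rewrite ?mul1e ?mul0e.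
apply: (le_trans (hC _ (nonneg_measurable_xmod mg))).
have -> : N (xpos \o (xmod \o g)) = N g by exact: (bfn_abs hN mg).
apply: (@le_trans _ _ (`|C|%:E * N g)).
  by rewrite lee_wpmul2r ?(bfn_ge0 hN)// lee_fin ler_norm.
by rewrite -[leRHS]mule1 lee_wpmul2l// lee_fin.
Qed.

(** A rearrangement below [s] at some time [t] means [mu {|f| > r} <= t] for some
    [r < s]. *)
Lemma distribution_function_fin f (s : R) : ACR mu N -> function_space N f ->
  (0 < s)%R -> distribution_function mu f s < +oo.
Proof.
move=> hacr fX s0; have [mf _] := fX.
have /(_ [set y | y < s%:E]) : rearrangement mu f t @[t --> +oo%R] --> (0 : \bar R).
  exact: hacr.
move=> /(_ _)[].
  apply: open_nbhs_nbhs; split; [exact: open_ereal_lt_ereal|by rewrite /= lte_fin].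
move=> M [_ hM]; have := hM (M + 1)%R; rewrite ltrDl ltr01 => /(_ isT) /=.
move=> /ereal_inf_lt[_ [r [r0 fr] <-]]; rewrite lte_fin => rs.
apply: (@le_lt_trans _ _ (distribution_function mu f r)).
  apply: le_measure; rewrite ?inE; try exact/measurable_xmod_gt/measurable_xmod.
  by move=> x /=; apply: lt_trans; rewrite lte_fin.
by rewrite (le_lt_trans fr)// ltry.
Qed.

Lemma integral_xmod_gt_fin f (s : R) : ACR mu N -> function_space N f ->
  (0 < s)%R -> \int[mu]_(x in [set x | s%:E < xmod (f x)]) xmod (f x) < +oo.
Proof.
move=> hacr fX s0; have [mf Nf] := fX.
have mS := measurable_xmod_gt s (measurable_xmod mf).
have [C hC] := bfn_integral hN mS (distribution_function_fin hacr fX s0).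
apply: (le_lt_trans (hC _ (nonneg_measurable_xmod mf))).
have -> : N (xpos \o (xmod \o f)) = N f by exact: (bfn_abs hN mf).
have Nfin : N f \is a fin_num by rewrite ge0_fin_numE// (bfn_ge0 hN).
by rewrite -(fineK Nfin) -EFinM ltry.
Qed.

Lemma function_space_ae_finite f : ACR mu N -> function_space N f ->
  {ae mu, forall x, exists w, f x = xfin w}.
Proof.
move=> hacr fX; have [mf Nf] := fX.
have mS := measurable_xmod_gt 1%R (measurable_xmod mf).
have mk : measurable_fun [set x | 1%:E < xmod (f x)] (xmod \o f).
  exact/measurable_funTS/measurable_xmod.
have /integrable_ae : mu.-integrable [set x | 1%:E < xmod (f x)] (xmod \o f).
  apply/integrableP; split => //.
  under eq_integral do rewrite gee0_abs ?xmod_ge0//.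
  exact: integral_xmod_gt_fin.
move=> /(_ mS); apply: filterS => x; rewrite /= /xfin.
by case: (f x) => [w _|/(_ (ltry 1))//]; exists w.
Qed.

(** A basic xi-neighbourhood given by the single seminorm of an indicator already
    controls the tails in L^1 + L^oo. *)
Lemma xi_limit_tail (u : nat -> T -> xcomplex R) g E : resonant mu ->
  xi_limit mu N u g -> measurable E -> 0 < mu E -> mu E < +oo ->
  forall e : R, (0 < e)%R -> \forall n \near \oo, xmeasurable (u n) /\
    \int[mu]_(x in [set x | e%:E < xmod (xsub (u n x) (g x))])
      xmod (xsub (u n x) (g x)) <= e%:E.
Proof.
move=> hres [[mg Ng] cug] mE E0 Efin e e0.
have muE : mu E = (fine (mu E))%:E by rewrite fineK// ge0_fin_numE// ltW.
set c := fine (mu E) in muE; have c0 : (0 < c)%R by rewrite -lte_fin -muE.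
have m0 : (0 < Num.min e (e * c))%R by rewrite lt_min e0 mulr_gt0.
pose V := [set h | function_space N h /\
  rearrangement_pairing mu (xindic E) (fun x => xsub (h x) (g x)) < (Num.min e (e * c))%:E%R].
have : xi_nbhs mu N g V.
  exists 1%N, (fun=> xindic E), (Num.min e (e * c))%R; split => // [j|h [hX small]].
    exact: (associate_xindic mE Efin).
  by split => //; exact: small ord0.
move=> /cug [n0 _ cV]; exists n0 => // n /cV [[mun _] small]; split => //.
have me := measurable_xsub mun mg.
apply: le_trans; last first.
  apply: ltW; apply: (lt_le_trans small); rewrite lee_fin ge_min lexx//.
apply: pairing_xindic_integral => //; first exact: ltW.
by rewrite (lt_le_trans small)// muE -EFinM lee_fin ge_min lexx orbT.
Qed.

End FunctionSpaceFacts.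

Section CesaroMeans.
Context {T : Type} {R : realType} (phi : T -> T).
Implicit Types f : T -> xcomplex R.

Lemma iter_composition_operator i f x :
  iter i (composition_operator phi) f x = f (iter i phi x).
Proof. by elim: i x => // i IH x; rewrite [in RHS]iterSr -IH. Qed.

Lemma cesaro_mean_finite n f (w : nat -> R[i]) x :
  (forall i, f (iter i phi x) = xfin (w i)) ->
  cesaro_mean phi n f x = xfin (n%:R^-1 * \sum_(i < n) w i)%R.
Proof.
move=> fw; rewrite /cesaro_mean.
suff -> : \big[xadd/xzero]_(i < n) iter i (composition_operator phi) f x
    = xfin (\sum_(i < n) w i)%R by [].
apply: (big_rec2 (fun a b => a = xfin b)) => // i b a _ ->.
by rewrite iter_composition_operator fw.
Qed.

Lemma part_average (P : {additive R[i] -> R}) n (w : nat -> R[i]) :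
  (forall (r : R) z, P (real_complex R r * z)%R = (r * P z)%R) ->
  P (n%:R^-1 * \sum_(i < n) w i)%R = (n%:R^-1 * \sum_(i < n) P (w i))%R.
Proof.
move=> PZ; rewrite -raddf_sum -PZ; congr (P (_ * _)%R).
by rewrite fmorphV rmorph_nat.
Qed.

End CesaroMeans.

Section CesaroConvergence.
Context {d : measure_display} {T : measurableType d} {R : realType}.
Context (mu : {measure set T -> \bar R}).
Context (N : (T -> xcomplex R) -> \bar R).
Context (hres : resonant mu).
Context (hN : banach_function_norm mu N).
Context (hacr : ACR mu N).
Context (phi : T -> T).
Context (hphi : conditionI mu phi).
Context (f g : T -> xcomplex R).
Context (fX : function_space N f).
Context (fg : xi_limit mu N (fun n => cesaro_mean phi n f) g).
Context (E : set T).
Context (mE : measurable E).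
Context (E0 : 0 < mu E).
Context (Efin : mu E < +oo).

Lemma ae_finite_orbit : {ae mu, forall x, exists w : nat -> R[i],
  forall i, f (iter i phi x) = xfin (w i)}.
Proof.
have [mphi [A [A0 hA]] _] := hphi.
have [B hB] := power_measure_bounded_by (ex_intro _ A (conj A0 hA)).
have : {ae mu, forall x i, exists w, f (iter i phi x) = xfin w}.
  apply: ae_foralln => i.
  exact: (ae_comp_iter mphi hB i (function_space_ae_finite hN hacr fX)).
by apply: filterS => x hx; have [w hw] := choice hx; exists w.
Qed.

Lemma ae_cvg_part (P : {additive R[i] -> R}) :
  (forall w, `|P w| <= ComplexField.Normc.normc w)%R ->
  (forall (r : R) z, P (real_complex R r * z)%R = (r * P z)%R) ->
  {ae mu, forall x, (n%:R^-1 * birkhoff_sum phi n (xpart P \o f) x)%R @[n --> \oo]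
                      --> xpart P (g x)}.
Proof.
move=> Pnorm PZ; have [mphi hA hI] := hphi.
have [B hB] := power_measure_bounded_by hA.
have [K hK] := conditionI_weak_type mphi hB hphi.
have [mf Nf] := fX; have [gX _] := fg; have [mg Ng] := gX.
have cP : continuous (P : R[i]^o -> R).
  by apply: lipschitz_continuous => z w; rewrite -raddfB; exact: Pnorm.
have mPf := measurable_xpart cP mf; have mPg := measurable_xpart cP mg.
have ffin : tail_integral mu 1 (xpart P \o f) < +oo.
  apply: (@le_lt_trans _ _ (\int[mu]_(x in [set x | 1%:E < xmod (f x)]) xmod (f x))).
    apply: (@tail_integral_le _ _ _ mu (xmod \o f)) => //.
    - exact: measurable_xmod.
    - by move=> x; exact: xmod_ge0.
    - apply: aeW => x /=; case: (f x) => [w|]/=; first by rewrite lee_fin.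
      exact: leey.
  exact: (integral_xmod_gt_fin hN).
apply: (pointwise_ergodic mphi hB hK mPf mPg ffin) => e e0.
have := xi_limit_tail hN hres fg mE E0 Efin e0.
apply: filterS => n [mn hn]; apply: le_trans hn.
pose k x := xmod (xsub (cesaro_mean phi n f x) (g x)).
apply: (@tail_integral_le _ _ _ mu k) => //.
- exact: measurable_xsub.
- by move=> x; exact: xmod_ge0.
- apply: measurable_funB => //; apply: measurable_funM => //.
  exact: measurable_birkhoff_sum.
- exact: ltW.
apply: filterS2 ae_finite_orbit (function_space_ae_finite hN hacr gX) => x [w fw] [z gz].
have -> : birkhoff_sum phi n (xpart P \o f) x = (\sum_(i < n) P (w i))%R.
  by apply: eq_bigr => i _; rewrite /= fw.
rewrite /k (cesaro_mean_finite n fw) gz /xsub /= mulN1r.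
by rewrite -part_average// gz -raddfB lee_fin; exact: Pnorm.
Qed.

Lemma ae_cvg_cesaro_mean :
  {ae mu, forall x, cesaro_mean phi n f x @[n --> \oo] --> g x}.
Proof.
have hRe : forall (r : R) z, complex.Re (real_complex R r * z)%R = (r * complex.Re z)%R.
  by move=> r [a b] /=; rewrite mul0r subr0.
have hIm : forall (r : R) z, complex.Im (real_complex R r * z)%R = (r * complex.Im z)%R.
  by move=> r [a b] /=; rewrite mul0r addr0.
have cRe := ae_cvg_part (P := @complex.Re R) (@Re_le_normc R) hRe.
have cIm := ae_cvg_part (P := @complex.Im R) (@Im_le_normc R) hIm.
have [gX _] := fg.
have gfin := function_space_ae_finite hN hacr gX.
apply: filterS2 (filterI ae_finite_orbit gfin) (filterI cRe cIm) => x [[w fw] [z gz]].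
rewrite /= gz => -[wRe wIm].
rewrite (_ : (fun n => _) = (fun n => xfin (n%:R^-1 * \sum_(i < n) w i)%R)); last first.
  by apply/funext => n; exact: cesaro_mean_finite.
have part (P : {additive R[i] -> R}) :
    (forall (r : R) z, P (real_complex R r * z)%R = (r * P z)%R) ->
    (fun n => n%:R^-1 * birkhoff_sum phi n (xpart P \o f) x)%R =
    (fun n => P (n%:R^-1 * \sum_(i < n) w i)%R).
  move=> PZ; apply/funext => n; rewrite part_average//; congr (_ * _)%R.
  by apply: eq_bigr => i _; rewrite /= fw.
rewrite (part (@complex.Re R) hRe) in wRe; rewrite (part (@complex.Im R) hIm) in wIm.
apply: xfin_cvg; apply/cvgrPdist_le => e e0.
have e2 : (0 < e / 2)%R by rewrite divr_gt0.
move/cvgrPdist_le : wRe => /(_ _ e2) wRe; move/cvgrPdist_le : wIm => /(_ _ e2) wIm.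
apply: filterS2 wRe wIm => n nRe nIm; rewrite sub0r normrN ger0_norm; last first.
  by rewrite -lee_fin; exact: (xmod_ge0 (xfin _)).
apply: le_trans (normc_le_ReIm _) _; rewrite !raddfB.
rewrite [leRHS](splitr e); apply: lerD; rewrite distrC; [exact: nRe|exact: nIm].
Qed.

End CesaroConvergence.

Theorem theorem6p8 (d : measure_display) (T : measurableType d) (R : realType)
    (mu : {measure set T -> \bar R})
    (hres : resonant mu)
    (N : (T -> xcomplex R) -> \bar R)
    (hN : banach_function_norm mu N)
    (hri : rearrangement_invariant mu N)
    (hacr : ACR mu N)
    (hacr' : ACR mu (associate_norm mu N))
    (phi : T -> T)
    (hphi : conditionI mu phi)
    (Top : (T -> xcomplex R) -> (T -> xcomplex R))
    (hTop : forall f, function_space N f ->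
       xi_limit mu N (fun n => cesaro_mean phi n f) (Top f)) :
  forall f, abs_continuous_part mu N f ->
    {ae mu, forall x, cesaro_mean phi n f x @[n --> \oo] --> Top f x}.
Proof.
move=> f [fX _]; have [[F cupF hF] _] := hres.
have [[i Fi]|F0] := pselect (exists i, 0 < mu (F i)).
  have [mFi Fifin] := hF i.
  exact: (ae_cvg_cesaro_mean hres hN hacr hphi fX (hTop f fX) mFi Fi Fifin).
exists [set: T]; split => //; rewrite cupF; apply/negligibleP.
  by apply: bigcupT_measurable => i; case: (hF i).
apply: negligible_bigcup => i; apply/negligibleP; first by case: (hF i).
by apply/eqP; rewrite -measure_le0 leNgt; apply/negP => ?; apply: F0; exists i.
Qed.
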